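(* Let $g_0=dr^2+f(r)^2d\theta^2$ be a smooth rotationally symmetric metric on $M=\mathbb{S}^1\times[-\rho,\rho]$ with $A_{g_0}(M)=1$, $R_{g_0}\ge0$, $k_{g_0}\le0$, which is symmetric under the reflection $r\mapsto -r$ and whose scalar curvature $R_{g_0}$, as a function of $r$, is nonincreasing in $|r|$. Then the scalar curvature of the normalised flow starting at $g_0$ is uniformly bounded: $\sup_{M\times[0,\infty)}R<\infty$.
   Context: $R$ denotes scalar curvature, $k_g$ the geodesic curvature of $\partial M$ w.r.t. the outward normal. The unnormalised flow solves $\partial_{\tilde t}\tilde g=-\tilde R\tilde g$, $k_{\tilde g}=k_{g_0}$ on $\partial M$, $\tilde g(0)=g_0$. The normalised flow is $g=\phi\tilde g$ with $\phi(\tilde t)$ chosen so that $A_g(M)=1$, reparametrised by $t=\int_0^{\tilde t}\phi(\tau)d\tau$; it solves $\partial_t g=(r-R)g$, $k_g=k_{g_0}/\sqrt{\phi}$ on $\partial M$, $g(0)=g_0$, with $r=\int_M R\,dA_g$; it exists for all time. Rotational symmetry, reflection symmetry and the property of curvature decreasing from the middle are preserved by the flow. *)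

(* Defs.v *)
From Stdlib Require Import Reals.
Open Scope R_scope.

Definition smooth1 (f : R -> R) : Prop :=
  exists D : nat -> R -> R,
    D 0%nat = f /\ forall n x, derivable_pt_lim (D n) x (D (S n) x).

Definition cont2_at (F : R -> R -> R) (r t : R) : Prop :=
  forall eps, 0 < eps -> exists delta, 0 < delta /\
    forall x s, Rabs (x - r) < delta -> Rabs (s - t) < delta ->
      Rabs (F x s - F r t) < eps.

Definition smooth2_pos (u : R -> R -> R) : Prop :=
  exists D : nat -> nat -> R -> R -> R,
    D 0%nat 0%nat = u /\
    forall m n r t, 0 < t ->
      derivable_pt_lim (fun x => D m n x t) r (D (S m) n r t) /\
      derivable_pt_lim (fun s => D m n r s) t (D m (S n) r t) /\
      cont2_at (D m n) r t.

(* Scalar curvature of g0 = dr^2 + f(r)^2 dtheta^2 (f2 = f''): R = -2 f''/f *)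
Definition scal0 (f f2 : R -> R) (r : R) : R := -2 * f2 r / f r.

(* Geodesic curvature of the boundary components of ([-rho,rho] x S^1, g0)
   w.r.t. the outward normal (+d/dr at r = rho, -d/dr at r = -rho). *)
Definition geod0_right (f f1 : R -> R) (rho : R) : R := f1 rho / f rho.
Definition geod0_left (f f1 : R -> R) (rho : R) : R := - f1 (- rho) / f (- rho).

(* Scalar curvature of g = exp(2u) g0 (u = u(r,t), ur = du/dr, urr = d^2u/dr^2):
   R_g = e^{-2u} (R_{g0} - 2 Delta_{g0} u),  Delta_{g0} u = u_rr + (f'/f) u_r. *)
Definition scal_conf (f f1 f2 : R -> R) (u ur urr : R -> R -> R) (r t : R) : R :=
  exp (-2 * u r t) * (scal0 f f2 r - 2 * (urr r t + f1 r / f r * ur r t)).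

(* Geodesic curvature of the boundary for g = exp(2u) g0:
   k_g = e^{-u} (k_{g0} + d u / d nu), nu outward unit normal of g0. *)
Definition geod_right (f f1 : R -> R) (u ur : R -> R -> R) (rho t : R) : R :=
  exp (- u rho t) * (geod0_right f f1 rho + ur rho t).
Definition geod_left (f f1 : R -> R) (u ur : R -> R -> R) (rho t : R) : R :=
  exp (- u (- rho) t) * (geod0_left f f1 rho - ur (- rho) t).

(* Main.v *)
Require Import Defs.
From Stdlib Require Import Reals Lra IndefiniteDescription Classical Ranalysis5.
From Coquelicot Require Import Coquelicot.
Open Scope R_scope.

(* Let [Y = 2 u - ln phi], so that [exp Y] is the conformal factor of the
   unnormalised flow; [R] is then minus the time derivative of [Y].

   For small times, with [s] the time of the unnormalised flow, the maximum
   principle gives [1 - C0 s <= exp Y <= 1] as soon as [R <= C0] initially.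
   Comparing the time shift [Y(s + h)] with the rescaled solution
   [Y(s / a) + ln a], [a = 1 - C0 h], and letting [h -> 0] yields
   [R <= C0 / (1 - C0 s)] for the unnormalised curvature; only the continuous
   attainment of the initial metric is used.

   Away from [t = 0], write the metric as [w (dy^2 + dtheta^2)] with
   [dy = dr / f], and put [q = (ln w)_y], [P = w R = - q_y], [H = P + q^2 / 2].
   Then [H_y = w R_y] and [H_t = R_yy - q R_y], while [H_y] has the favourable
   sign on a boundary circle where [R > 0]; hence [H] stays bounded. Since
   [q_y = q^2 / 2 - H] and [q] is bounded on the boundary, [q] is bounded,
   so [w] has bounded oscillation, and the area constraint bounds [w] below.
   Thus [R = P / w] is bounded. *)

(** * Maximum principle on a rectangle *)

(** Maximise in space for each fixed time, with maximiser [X t]. The maximal value depends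
    continuously on time by uniform continuity of [F], although [X] may jump, so it attains its own
    maximum. *)
Lemma rectangle_max (F : R -> R -> R) (a b c d : R) :
  a <= b -> c <= d ->
  (forall x t, a <= x <= b -> c <= t <= d -> continuity_2d_pt F x t) ->
  exists x0 t0, a <= x0 <= b /\ c <= t0 <= d /\
    forall x t, a <= x <= b -> c <= t <= d -> F x t <= F x0 t0.
Proof.
intros Hab Hcd HF.
assert (HX : forall t, exists x0, c <= t <= d ->
          a <= x0 <= b /\ forall x, a <= x <= b -> F x t <= F x0 t).
{ intros t.
  destruct (Rle_dec c t) as [H1|H1]; [|exists 0; lra].
  destruct (Rle_dec t d) as [H2|H2]; [|exists 0; lra].
  destruct (continuity_ab_maj (fun x => F x t) a b Hab) as [x0 [Hm Hx0]].
  - intros x Hx eps Heps.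
    destruct (HF x t Hx (conj H1 H2) (mkposreal eps Heps)) as [de Hde].
    exists de; split; [apply cond_pos|].
    intros y [_ Hy]; apply Hde; [exact Hy|].
    rewrite Rminus_diag, Rabs_R0; apply cond_pos.
  - exists x0; intros _; split; [exact Hx0|exact Hm]. }
destruct (functional_choice _ HX) as [X HXs].
(* [continuity_ab_maj] asks for two-sided continuity at the end points, while [X] is controlled only
   on [[c, d]]; hence time is clamped. *)
pose (cl := fun t => Rmax c (Rmin d t)).
assert (Hcl : forall t, c <= cl t <= d).
{ intros t; unfold cl, Rmax, Rmin.
  destruct (Rle_dec d t); destruct (Rle_dec _ _); lra. }
assert (Hcl_id : forall t, c <= t <= d -> cl t = t).
{ intros t Ht; unfold cl, Rmax, Rmin.
  destruct (Rle_dec d t); destruct (Rle_dec _ _); lra. }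
assert (Hcl_lip : forall s t, Rabs (cl s - cl t) <= Rabs (s - t)).
{ intros s t; unfold cl, Rmax, Rmin.
  destruct (Rle_dec d s); destruct (Rle_dec d t); repeat destruct (Rle_dec _ _);
  unfold Rabs; repeat destruct (Rcase_abs _); lra. }
destruct (continuity_ab_maj (fun t => F (X (cl t)) (cl t)) c d Hcd) as [t0 [Hm Ht0]].
- intros t _ eps Heps.
  destruct (uniform_continuity_2d F a b c d HF (mkposreal eps Heps)) as [de Hde].
  exists de; split; [apply cond_pos|].
  intros s [_ Hs]; simpl in Hs |- *; unfold R_dist in *.
  destruct (HXs _ (Hcl s)) as [Hs1 Hs2].
  destruct (HXs _ (Hcl t)) as [Ht1 Ht2].
  assert (Hd : Rabs (cl s - cl t) < de) by (eapply Rle_lt_trans; [apply Hcl_lip|exact Hs]).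
  assert (H0 : forall x : R, Rabs (x - x) < de)
    by (intros x; rewrite Rminus_diag, Rabs_R0; apply cond_pos).
  pose proof (Hde _ _ _ _ Hs1 (Hcl t) Hs1 (Hcl s) (H0 _) Hd) as K1.
  pose proof (Hde _ _ _ _ Ht1 (Hcl t) Ht1 (Hcl s) (H0 _) Hd) as K2.
  pose proof (Hs2 _ Ht1); pose proof (Ht2 _ Hs1); simpl in K1, K2.
  apply Rabs_def2 in K1; apply Rabs_def2 in K2; apply Rabs_def1; lra.
- exists (X t0), t0. destruct (HXs _ Ht0) as [H1 H2].
  split; [exact H1|split; [exact Ht0|]].
  intros x t Hx Ht; specialize (Hm t Ht); rewrite !Hcl_id in Hm by assumption.
  eapply Rle_trans; [apply (HXs t Ht), Hx|exact Hm].
Qed.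

(* The hypothesis [H] is only tested at points where [F > m] is maximal in
   space at time [t] and maximal in time over [[t0, t]]. *)
Lemma parabolic_max_principle (F : R -> R -> R) (a b t0 t1 m : R) :
  a <= b ->
  (forall x t, a <= x <= b -> t0 <= t <= t1 -> continuity_2d_pt F x t) ->
  (forall x, a <= x <= b -> F x t0 <= m) ->
  (forall x t, a <= x <= b -> t0 < t <= t1 -> m < F x t ->
     (forall y, a <= y <= b -> F y t <= F x t) ->
     (forall s, t0 <= s <= t -> F x s <= F x t) -> False) ->
  forall x t, a <= x <= b -> t0 <= t <= t1 -> F x t <= m.
Proof.
intros Hab HF H0 H x t Hx Ht.
destruct (rectangle_max F a b t0 t1 Hab ltac:(lra) HF) as [x0 [s0 [Hx0 [Hs0 Hm]]]].
destruct (Rle_lt_dec (F x t) m) as [|Hgt]; [assumption|exfalso].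
pose proof (Hm x t Hx Ht).
assert (s0 <> t0) by (intros ->; specialize (H0 x0 Hx0); lra).
apply (H x0 s0 Hx0); try lra; intros; apply Hm; lra.
Qed.

(** * One-variable calculus: derivative tests and a change of time *)

Lemma strictly_increasing_at (g : R -> R) (x l : R) :
  derivable_pt_lim g x l -> 0 < l ->
  exists d, 0 < d /\ (forall h, 0 < h < d -> g x < g (x + h)) /\
    (forall h, 0 < h < d -> g (x - h) < g x).
Proof.
intros Hg Hl; destruct (Hg l Hl) as [[d Hd] H]; simpl in H.
exists d; split; [exact Hd|].
assert (K : forall h, h <> 0 -> Rabs h < d -> 0 < (g (x + h) - g x) / h).
{ intros h H1 H2; specialize (H h H1 H2); apply Rabs_def2 in H; lra. }
split; intros h Hh.
- specialize (K h ltac:(lra)); rewrite Rabs_pos_eq in K by lra.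
  specialize (K ltac:(lra)).
  replace (g (x + h)) with (g x + (g (x + h) - g x) / h * h) by (field; lra).
  pose proof (Rmult_lt_0_compat _ h K ltac:(lra)); lra.
- specialize (K (- h) ltac:(lra)); rewrite Rabs_Ropp, Rabs_pos_eq in K by lra.
  specialize (K ltac:(lra)).
  replace (x + - h) with (x - h) in K by ring.
  replace (g (x - h)) with (g x - (g (x - h) - g x) / - h * h) by (field; lra).
  pose proof (Rmult_lt_0_compat _ h K ltac:(lra)); lra.
Qed.

Lemma derive_ge0_of_left_max (g : R -> R) (t0 t l : R) :
  t0 < t -> derivable_pt_lim g t l ->
  (forall s, t0 <= s <= t -> g s <= g t) -> 0 <= l.
Proof.
intros Ht Hg Hm; destruct (Rle_lt_dec 0 l) as [|Hl]; [assumption|exfalso].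
destruct (strictly_increasing_at (- g)%F t (- l)) as [d [Hd [_ H]]]; [|lra|].
- apply derivable_pt_lim_opp, Hg.
- pose (h := Rmin (d / 2) (t - t0)).
  assert (0 < h /\ h <= d / 2 /\ h <= t - t0)
    by (repeat split; [apply Rmin_pos; lra|apply Rmin_l|apply Rmin_r]).
  specialize (H h ltac:(lra)); specialize (Hm (t - h) ltac:(lra)).
  unfold opp_fct in H; lra.
Qed.

(* The sign conditions at the end points make the first derivative vanish also
   at a boundary maximum, so that the second derivative test applies there. *)
Lemma second_derivative_test (g g1 : R -> R) (a b x g2 : R) :
  a < b -> a <= x <= b ->
  (forall y, a <= y <= b -> derivable_pt_lim g y (g1 y)) ->
  derivable_pt_lim g1 x g2 ->
  (forall y, a <= y <= b -> g y <= g x) ->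
  (x = b -> g1 b <= 0) -> (x = a -> 0 <= g1 a) ->
  g1 x = 0 /\ g2 <= 0.
Proof.
intros Hab Hx Hg Hg1 Hm Hb Ha.
assert (H1 : g1 x <= 0).
{ destruct (Req_dec x b) as [->|Hxb]; [now apply Hb|].
  destruct (Rle_lt_dec (g1 x) 0) as [|Hl]; [assumption|exfalso].
  destruct (strictly_increasing_at g x (g1 x) (Hg x Hx) Hl) as [d [Hd [H _]]].
  pose (h := Rmin (d / 2) (b - x)).
  assert (0 < h /\ h <= d / 2 /\ h <= b - x)
    by (repeat split; [apply Rmin_pos; lra|apply Rmin_l|apply Rmin_r]).
  specialize (H h ltac:(lra)); specialize (Hm (x + h) ltac:(lra)); lra. }
assert (H2 : 0 <= g1 x).
{ destruct (Req_dec x a) as [->|Hxa]; [now apply Ha|].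
  apply (derive_ge0_of_left_max g a x); [lra|now apply Hg|].
  intros s Hs; apply Hm; lra. }
split; [lra|].
destruct (Rle_lt_dec g2 0) as [|Hl]; [assumption|exfalso].
destruct (strictly_increasing_at g1 x g2 Hg1 Hl) as [d [Hd [Hr Hlft]]].
(* As [g1 x = 0] and [g2 > 0], [g1] is negative just left of [x] and positive just right of it. By
   the mean value theorem [g] exceeds [g x] on whichever side stays in [[a, b]]. *)
destruct (Req_dec x b) as [Hxb|Hxb].
- pose (h := Rmin (d / 2) (x - a)).
  assert (0 < h /\ h <= d / 2 /\ h <= x - a)
    by (repeat split; [apply Rmin_pos; lra|apply Rmin_l|apply Rmin_r]).
  destruct (MVT_cor2 g g1 (x - h) x) as [y [Hy1 Hy2]]; [lra| |].
  + intros; apply Hg; lra.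
  + specialize (Hlft (x - y) ltac:(lra)).
    replace (x - (x - y)) with y in Hlft by ring.
    specialize (Hm (x - h) ltac:(lra)).
    assert (g1 y * (x - (x - h)) < 0) by (apply Rmult_neg_pos; lra). lra.
- pose (h := Rmin (d / 2) (b - x)).
  assert (0 < h /\ h <= d / 2 /\ h <= b - x)
    by (repeat split; [apply Rmin_pos; lra|apply Rmin_l|apply Rmin_r]).
  destruct (MVT_cor2 g g1 x (x + h)) as [y [Hy1 Hy2]]; [lra| |].
  + intros; apply Hg; lra.
  + specialize (Hr (y - x) ltac:(lra)).
    replace (x + (y - x)) with y in Hr by ring.
    specialize (Hm (x + h) ltac:(lra)).
    assert (0 < g1 y * (x + h - x)) by (apply Rmult_lt_0_compat; lra). lra.
Qed.

(** Serves to differentiate the boundary conditions in time, which are identities for positive times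
    only. *)
Lemma derive_unique_on_interval (g h : R -> R) (a b x g1 h1 : R) :
  a < b -> a <= x <= b -> (forall y, a <= y <= b -> g y = h y) ->
  derivable_pt_lim g x g1 -> derivable_pt_lim h x h1 -> g1 = h1.
Proof.
assert (Hle : forall g h g1 h1, a < b -> a <= x <= b ->
   (forall y, a <= y <= b -> g y = h y) ->
   derivable_pt_lim g x g1 -> derivable_pt_lim h x h1 -> g1 <= h1).
{ clear; intros g h g1 h1 Hab Hx E Hg Hh.
  destruct (Rle_lt_dec g1 h1) as [|Hl]; [assumption|exfalso].
  destruct (strictly_increasing_at (g - h)%F x (g1 - h1)) as [d [Hd [H1 H2]]]; [|lra|].
  - now apply derivable_pt_lim_minus.
  - unfold minus_fct in *.
    destruct (Req_dec x b) as [->|Hxb].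
    + pose (k := Rmin (d / 2) (b - a)).
      assert (0 < k /\ k <= d / 2 /\ k <= b - a)
        by (repeat split; [apply Rmin_pos; lra|apply Rmin_l|apply Rmin_r]).
      specialize (H2 k ltac:(lra)).
      rewrite (E (b - k)), (E b) in H2 by lra; lra.
    + pose (k := Rmin (d / 2) (b - x)).
      assert (0 < k /\ k <= d / 2 /\ k <= b - x)
        by (repeat split; [apply Rmin_pos; lra|apply Rmin_l|apply Rmin_r]).
      specialize (H1 k ltac:(lra)).
      rewrite (E (x + k)), (E x) in H1 by lra; lra. }
intros Hab Hx E Hg Hh; apply Rle_antisym.
- now apply (Hle g h).
- apply (Hle h g); try assumption; intros; symmetry; now apply E.
Qed.

(** A maximum of [g] above [Q] cannot lie at [b], and elsewhere [g] still increases to its right. *)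
Lemma le_of_increasing_above (g g1 : R -> R) (a b Q : R) :
  a <= b -> (forall x, a <= x <= b -> derivable_pt_lim g x (g1 x)) -> g b <= Q ->
  (forall x, a <= x <= b -> Q < g x -> 0 < g1 x) ->
  forall x, a <= x <= b -> g x <= Q.
Proof.
intros Hab Hg Hb Hinc x Hx.
destruct (continuity_ab_maj g a b Hab) as [y [Hm Hy]].
{ intros z Hz; apply derivable_continuous_pt; exists (g1 z); now apply Hg. }
destruct (Rle_lt_dec (g x) Q) as [|K]; [assumption|exfalso].
pose proof (Hm x Hx).
assert (y <> b) by (intros ->; lra).
destruct (strictly_increasing_at g y (g1 y) (Hg y Hy) (Hinc y Hy ltac:(lra))) as [d [Hd [Hr _]]].
pose (h := Rmin (d / 2) (b - y)).
assert (0 < h /\ h <= d / 2 /\ h <= b - y)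
  by (repeat split; [apply Rmin_pos; lra|apply Rmin_l|apply Rmin_r]).
specialize (Hr h ltac:(lra)); specialize (Hm (y + h) ltac:(lra)); lra.
Qed.

(* [T] is the inverse of [t |-> RInt g 0 t]. *)
Lemma time_change (g : R -> R) :
  (forall t, continuous g t) -> (forall t, 0 < g t) ->
  exists (T : R -> R) (s1 : R), 0 < s1 /\
    (forall s, 0 < s < s1 -> 0 < T s /\ derivable_pt_lim T s (/ g (T s))) /\
    (forall e, 0 < e -> exists d, 0 < d /\ forall s, 0 < s < d -> s < s1 -> T s < e) /\
    (forall t, 0 < t < 1 -> exists s, 0 < s < s1 /\ T s = t).
Proof.
intros Hc Hp.
set (S := fun t => RInt g 0 t).
assert (HS : forall t, derivable_pt_lim S t (g t)).
{ intros t; apply is_derive_Reals, (is_derive_RInt g S 0).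
  - exists (mkposreal 1 Rlt_0_1); intros y _; apply (RInt_correct g 0 y).
    apply (ex_RInt_continuous g); intros; apply Hc.
  - apply Hc. }
assert (Hinc : forall s t, s < t -> S s < S t).
{ intros s t Hst; destruct (MVT_cor2 S g s t Hst) as [y [Hy _]]; [intros; apply HS|].
  pose proof (Rmult_lt_0_compat _ _ (Hp y) (proj2 (Rlt_0_minus s t) Hst)); lra. }
assert (Hinv : forall s t, S s < S t -> s < t).
{ intros s t H; destruct (Rlt_le_dec s t) as [|[K|K]]; [assumption| |].
  - apply Hinc in K; lra.
  - subst; lra. }
assert (S0 : S 0 = 0) by (unfold S; now rewrite RInt_point).
assert (HT : forall s, exists t, S 0 <= s <= S 1 -> 0 <= t <= 1 /\ S t = s).
{ intros s; destruct (Rle_dec (S 0) s) as [H1|]; [|exists 0; lra].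
  destruct (Rle_dec s (S 1)) as [H2|]; [|exists 0; lra].
  destruct (f_interv_is_interv S 0 1 s) as [t Ht]; [lra|lra| |now exists t].
  intros x _; apply derivable_continuous_pt; exists (g x); apply HS. }
destruct (functional_choice _ HT) as [T HTs].
assert (Hin : forall s, S 0 < s < S 1 -> 0 < T s < 1 /\ S (T s) = s).
{ intros s Hs; destruct (HTs s ltac:(lra)) as [H1 H2]; split; [|exact H2].
  split; apply Hinv; lra. }
(* Only small times matter later; the upper limit 1 is an arbitrary choice. *)
exists T, (S 1); rewrite S0 in *.
assert (HS1 : 0 < S 1) by (rewrite <- S0; apply Hinc; lra).
split; [exact HS1|split; [|split]].
- intros s Hs; destruct (Hin s Hs) as [H1 H2]; split; [apply H1|].
  (* The inverse function rule used below takes continuity of the inverse as a premise; here it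
     follows from strict monotonicity of [S]. *)
  assert (Hcont : continuity_pt T s).
  { intros eps Heps.
    pose (e := Rmin eps (Rmin (T s) (1 - T s))).
    assert (He : 0 < e /\ e <= eps /\ e <= T s /\ e <= 1 - T s).
    { unfold e; split; [repeat apply Rmin_pos; lra|].
      pose proof (Rmin_l eps (Rmin (T s) (1 - T s))).
      pose proof (Rmin_r eps (Rmin (T s) (1 - T s))).
      pose proof (Rmin_l (T s) (1 - T s)).
      pose proof (Rmin_r (T s) (1 - T s)). lra. }
    assert (K1 : S (T s - e) < s) by (rewrite <- H2 at 2; apply Hinc; lra).
    assert (K2 : s < S (T s + e)) by (rewrite <- H2 at 1; apply Hinc; lra).
    assert (K3 : 0 <= S (T s - e)).
    { destruct (Req_dec (T s - e) 0) as [->|]; [lra|].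
      left; rewrite <- S0; apply Hinc; lra. }
    assert (K4 : S (T s + e) <= S 1).
    { destruct (Req_dec (T s + e) 1) as [->|]; [lra|].
      left; apply Hinc; lra. }
    exists (Rmin (s - S (T s - e)) (S (T s + e) - s)); split.
    - apply Rmin_pos; lra.
    - intros s' [_ Hs']; simpl in *; unfold R_dist in *.
      pose proof (Rmin_l (s - S (T s - e)) (S (T s + e) - s)).
      pose proof (Rmin_r (s - S (T s - e)) (S (T s + e) - s)).
      apply Rabs_def2 in Hs'.
      destruct (Hin s' ltac:(lra)) as [J1 J2].
      assert (T s - e < T s') by (apply Hinv; lra).
      assert (T s' < T s + e) by (apply Hinv; lra).
      apply Rabs_def1; lra. }
  assert (Prf : forall a, T 0 <= a <= T (S 1) -> derivable_pt S a)
    by (intros a _; exists (g a); apply HS).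
  assert (Prg : T 0 <= T s <= T (S 1)).
  { destruct (HTs 0 ltac:(lra)) as [J1 J2]; destruct (HTs (S 1) ltac:(lra)) as [J3 J4].
    split; left; apply Hinv; lra. }
  pose proof (derivable_pt_lim_recip_interv S T 0 (S 1) s Prf Hcont HS1 Hs Prg) as K.
  rewrite (derive_pt_eq_0 S (T s) (g (T s)) _ (HS _)) in K.
  replace (/ g (T s)) with (1 / g (T s)) by (unfold Rdiv; ring).
  apply K.
  + intros x Hx; unfold comp, id; apply HTs; lra.
  + pose proof (Hp (T s)); lra.
- intros e He; exists (S e); split; [rewrite <- S0; apply Hinc; lra|].
  intros s Hs Hs1; apply Hinv; destruct (Hin s ltac:(lra)) as [_ ->]; lra.
- intros t Ht; exists (S t).
  assert (K : 0 < S t < S 1) by (split; [rewrite <- S0|]; apply Hinc; lra).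
  split; [exact K|].
  destruct (Hin (S t) K) as [_ H].
  destruct (Rtotal_order (T (S t)) t) as [J|[J|J]]; [apply Hinc in J|exact J|apply Hinc in J]; lra.
Qed.

(** * Joint continuity in space and time *)

Lemma continuity_2d_pt_fst (g : R -> R) (x t : R) :
  continuity_pt g x -> continuity_2d_pt (fun y _ => g y) x t.
Proof.
intros H; apply (continuity_1d_2d_pt_comp g (fun y _ => y)); [exact H|].
apply continuity_2d_pt_id1.
Qed.

Lemma continuity_2d_pt_snd (g : R -> R) (x t : R) :
  continuity_pt g t -> continuity_2d_pt (fun _ s => g s) x t.
Proof.
intros H; apply (continuity_1d_2d_pt_comp g (fun _ s => s)); [exact H|].
apply continuity_2d_pt_id2.
Qed.

Lemma continuity_2d_pt_reparam (F : R -> R -> R) (g : R -> R) (x t : R) :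
  continuity_2d_pt F x (g t) -> continuity_pt g t ->
  continuity_2d_pt (fun y s => F y (g s)) x t.
Proof.
intros HF Hg eps; destruct (HF eps) as [d Hd].
destruct (continuity_2d_pt_snd g x t Hg d) as [d' Hd'].
exists (mkposreal _ (Rmin_pos _ _ (cond_pos d) (cond_pos d'))); simpl.
intros y s Hy Hs; apply Hd.
- eapply Rlt_le_trans; [exact Hy|apply Rmin_l].
- apply (Hd' y s); eapply Rlt_le_trans; [exact Hy|apply Rmin_r|exact Hs|apply Rmin_r].
Qed.

Lemma continuity_pt_of_derive (g : R -> R) (x l : R) :
  derivable_pt_lim g x l -> continuity_pt g x.
Proof. intros H; apply derivable_continuous_pt; now exists l. Qed.

Lemma continuity_pt_exp (x : R) : continuity_pt exp x.
Proof. eapply continuity_pt_of_derive, derivable_pt_lim_exp. Qed.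

Lemma exp_monotone (x y : R) : x <= y -> exp x <= exp y.
Proof. intros [H| ->]; [left; now apply exp_increasing|right; reflexivity]. Qed.

Lemma exp_nonpos_le1 (x : R) : x <= 0 -> exp x <= 1.
Proof. intros H; rewrite <- exp_0; now apply exp_monotone. Qed.

Ltac continuity_2d :=
  repeat first
    [ apply continuity_2d_pt_const
    | assumption
    | apply continuity_2d_pt_plus
    | apply continuity_2d_pt_minus
    | apply continuity_2d_pt_opp
    | apply continuity_2d_pt_mult
    | apply (continuity_1d_2d_pt_comp exp); [apply continuity_pt_exp|] ].

(** * The flow, its boundary conditions and the upper bound on the conformal factor *)

Section Flow.

Variables (rho : R) (f f1 f2 : R -> R).
Variables (u ux uxx ut uxt uxxt : R -> R -> R) (phi rbar : R -> R).

Let I (x : R) : Prop := - rho <= x <= rho.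
Let k0r : R := geod0_right f f1 rho.
Let k0l : R := geod0_left f f1 rho.
Let scal : R -> R -> R := scal_conf f f1 f2 u ux uxx.

Hypothesis Hrho : 0 < rho.
Hypothesis Hf1 : forall x, derivable_pt_lim f x (f1 x).
Hypothesis Hf2 : forall x, derivable_pt_lim f1 x (f2 x).
Hypothesis f2_cont : forall x, continuity_pt f2 x.
Hypothesis Hfpos : forall x, I x -> 0 < f x.
Hypothesis HR0 : forall x, I x -> 0 <= scal0 f f2 x.
Hypothesis Hk0r : k0r <= 0.
Hypothesis Hk0l : k0l <= 0.

Hypothesis Hux : forall x t, 0 < t -> derivable_pt_lim (fun y => u y t) x (ux x t).
Hypothesis Huxx : forall x t, 0 < t -> derivable_pt_lim (fun y => ux y t) x (uxx x t).
Hypothesis Hut : forall x t, 0 < t -> derivable_pt_lim (u x) t (ut x t).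
(** Each mixed derivative is given as a derivative in both variables, which encodes that partial
    derivatives commute. *)
Hypothesis Huxt : forall x t, 0 < t -> derivable_pt_lim (ux x) t (uxt x t).
Hypothesis Hutx : forall x t, 0 < t -> derivable_pt_lim (fun y => ut y t) x (uxt x t).
Hypothesis Huxxt : forall x t, 0 < t -> derivable_pt_lim (uxx x) t (uxxt x t).
Hypothesis Huxtx : forall x t, 0 < t -> derivable_pt_lim (fun y => uxt y t) x (uxxt x t).
Hypothesis u_cont : forall x t, 0 < t -> continuity_2d_pt u x t.
Hypothesis ux_cont : forall x t, 0 < t -> continuity_2d_pt ux x t.
Hypothesis uxx_cont : forall x t, 0 < t -> continuity_2d_pt uxx x t.

Hypothesis Hinit : forall x0, I x0 -> forall eps, 0 < eps ->
  exists delta, 0 < delta /\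
    forall x t, I x -> Rabs (x - x0) < delta -> 0 < t < delta -> Rabs (u x t) < eps.
Hypothesis Hflow : forall x t, I x -> 0 < t -> 2 * ut x t = rbar t - scal x t.
Hypothesis Hphipos : forall t, 0 <= t -> 0 < phi t.
Hypothesis Hphi0 : phi 0 = 1.
Hypothesis Hphic : forall eps, 0 < eps -> exists delta, 0 < delta /\
  forall t, 0 < t < delta -> Rabs (phi t - 1) < eps.
Hypothesis Hdphi : forall t, 0 < t -> derivable_pt_lim phi t (rbar t * phi t).
Hypothesis Hbdr : forall t, 0 < t ->
  geod_right f f1 u ux rho t = k0r / sqrt (phi t).
Hypothesis Hbdl : forall t, 0 < t ->
  geod_left f f1 u ux rho t = k0l / sqrt (phi t).

(* [exp (Y x t)] is the conformal factor of the unnormalised flow. *)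
Let Y (x t : R) : R := 2 * u x t - ln (phi t).

Lemma phi_cont (t : R) : 0 < t -> continuity_pt phi t.
Proof. intros Ht; eapply continuity_pt_of_derive, Hdphi, Ht. Qed.

Lemma ln_phi_derive (t : R) : 0 < t -> derivable_pt_lim (fun s => ln (phi s)) t (rbar t).
Proof.
intros Ht; pose proof (Hphipos t ltac:(lra)) as Hp.
replace (rbar t) with (/ phi t * (rbar t * phi t)) by (field; lra).
apply (derivable_pt_lim_comp phi ln); [now apply Hdphi|now apply derivable_pt_lim_ln].
Qed.

Lemma Y_cont (x t : R) : 0 < t -> continuity_2d_pt Y x t.
Proof.
intros Ht; pose proof (u_cont x t Ht).
unfold Y; continuity_2d.
apply (continuity_2d_pt_snd (fun s => ln (phi s))).
eapply continuity_pt_of_derive, ln_phi_derive, Ht.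
Qed.

Lemma Y_derive_time (x t : R) : I x -> 0 < t -> derivable_pt_lim (Y x) t (- scal x t).
Proof.
intros Hx Ht; replace (- scal x t) with (2 * ut x t - rbar t) by (rewrite Hflow by assumption; ring).
unfold Y; apply derivable_pt_lim_minus; [|now apply ln_phi_derive].
apply derivable_pt_lim_scal, Hut, Ht.
Qed.

Lemma exp_half_Y (x t : R) : 0 < t -> exp (Y x t / 2) = exp (u x t) / sqrt (phi t).
Proof.
intros Ht; pose proof (Hphipos t ltac:(lra)) as Hp.
assert (E : exp (ln (phi t) / 2) = sqrt (phi t)).
{ apply Rsqr_inj; [left; apply exp_pos|apply sqrt_pos|].
  rewrite Rsqr_sqrt by lra; unfold Rsqr; rewrite <- exp_plus.
  replace (ln (phi t) / 2 + ln (phi t) / 2) with (ln (phi t)) by field.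
  now apply exp_ln. }
unfold Y; replace ((2 * u x t - ln (phi t)) / 2) with (u x t + - (ln (phi t) / 2)) by field.
rewrite exp_plus, exp_Ropp, E; reflexivity.
Qed.

(** The geodesic curvature condition becomes a nonlinear Robin condition in [Y]. As [k0r <= 0], its
    right-hand side is nonincreasing in [Y], the sign that the maximum principle needs at the
    boundary. *)
Lemma ux_right (t : R) : 0 < t -> ux rho t = k0r * (exp (Y rho t / 2) - 1).
Proof.
intros Ht; rewrite exp_half_Y by exact Ht; specialize (Hbdr t Ht).
unfold geod_right in Hbdr; fold k0r in Hbdr.
assert (E : k0r + ux rho t = exp (u rho t) * (k0r / sqrt (phi t))).
{ rewrite <- Hbdr, <- Rmult_assoc, <- exp_plus, Rplus_opp_r, exp_0; ring. }
replace (ux rho t) with (k0r + ux rho t - k0r) by ring; rewrite E; unfold Rdiv; ring.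
Qed.

Lemma ux_left (t : R) : 0 < t -> - ux (- rho) t = k0l * (exp (Y (- rho) t / 2) - 1).
Proof.
intros Ht; rewrite exp_half_Y by exact Ht; specialize (Hbdl t Ht).
unfold geod_left in Hbdl; fold k0l in Hbdl.
assert (E : k0l - ux (- rho) t = exp (u (- rho) t) * (k0l / sqrt (phi t))).
{ rewrite <- Hbdl, <- Rmult_assoc, <- exp_plus, Rplus_opp_r, exp_0; ring. }
replace (- ux (- rho) t) with (k0l - ux (- rho) t - k0l) by ring; rewrite E; unfold Rdiv; ring.
Qed.

(** Compactness of the interval makes the pointwise attainment of the initial metric uniform in
    space. *)
Lemma Y_init (eps : R) : 0 < eps -> exists delta, 0 < delta /\
  forall x t, I x -> 0 < t < delta -> Rabs (Y x t) < eps.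
Proof.
intros Heps.
assert (HX : forall x0, exists d : posreal, I x0 -> forall x t, I x ->
   Rabs (x - x0) < d -> 0 < t < d -> Rabs (u x t) < eps / 4).
{ intros x0; destruct (Rle_dec (- rho) x0) as [H1|H1];
    [|exists (mkposreal 1 Rlt_0_1); unfold I; lra].
  destruct (Rle_dec x0 rho) as [H2|H2]; [|exists (mkposreal 1 Rlt_0_1); unfold I; lra].
  destruct (Hinit x0 (conj H1 H2) (eps / 4) ltac:(lra)) as [d [Hd H]].
  exists (mkposreal d Hd); intros _; exact H. }
destruct (functional_choice _ HX) as [delta Hdelta].
destruct (compactness_value_1d (- rho) rho delta) as [d Hd].
assert (Hln : exists e, 0 < e /\ forall z, Rabs (z - 1) < e -> Rabs (ln z) < eps / 2).
{ destruct (continuity_pt_of_derive ln 1 _ (derivable_pt_lim_ln 1 Rlt_0_1) (eps / 2))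
    as [e [He H]]; [lra|].
  exists e; split; [exact He|]; intros z Hz.
  destruct (Req_dec z 1) as [->|Hz1]; [rewrite ln_1, Rabs_R0; lra|].
  specialize (H z); simpl in H; unfold R_dist in H; rewrite ln_1, Rminus_0_r in H.
  apply H; split; [|exact Hz]; repeat split; auto. }
destruct Hln as [e [He Hln]].
destruct (Hphic e He) as [d2 [Hd2 Hp]].
exists (Rmin d d2); split; [apply Rmin_pos; [apply cond_pos|exact Hd2]|].
intros x t Hx Ht.
pose proof (Rmin_l d d2); pose proof (Rmin_r d d2).
assert (K : Rabs (u x t) < eps / 4).
{ destruct (Rlt_dec (Rabs (u x t)) (eps / 4)) as [|K]; [assumption|exfalso].
  apply (Hd x Hx); intros [x0 [H1 [H2 H3]]]; apply K.
  apply (Hdelta x0 H1 x t Hx H2); lra. }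
specialize (Hln (phi t) (Hp t ltac:(lra))).
apply Rabs_def2 in K; apply Rabs_def2 in Hln; unfold Y; apply Rabs_def1; lra.
Qed.

Lemma I_max_critical (g g1 : R -> R) (x g2 : R) :
  I x -> (forall y, I y -> derivable_pt_lim g y (g1 y)) ->
  derivable_pt_lim g1 x g2 -> (forall y, I y -> g y <= g x) ->
  (x = rho -> g1 rho <= 0) -> (x = - rho -> 0 <= g1 (- rho)) ->
  g1 x = 0 /\ g2 <= 0.
Proof. intros; apply (second_derivative_test g g1 (- rho) rho x g2); unfold I in *; auto; lra. Qed.

Lemma scal_at_critical (x t : R) : ux x t = 0 ->
  scal x t = exp (-2 * u x t) * (scal0 f f2 x - 2 * uxx x t).
Proof. intros E; unfold scal, scal_conf; rewrite E; f_equal; ring. Qed.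

Lemma exp_half_ge1 (y : R) : 0 <= y -> 1 <= exp (y / 2).
Proof. intros H; pose proof (exp_ineq1_le (y / 2)); lra. Qed.

(** At a positive spatial maximum of [Y] the Robin condition gives the outward derivative the sign
    required by the second derivative test. There [ux = 0] and [uxx <= 0], so the curvature is
    nonnegative because the initial one is, and [Y] does not increase in time. *)
Lemma Y_nonpos (x t : R) : I x -> 0 < t -> Y x t <= 0.
Proof.
intros Hx1 Ht1; destruct (Rle_lt_dec (Y x t) 0) as [|Hc]; [assumption|exfalso].
set (c := Y x t) in *.
destruct (Y_init (c / 4) ltac:(lra)) as [d [Hd Hini]].
pose (s := Rmin (d / 2) (t / 2)).
assert (Hs : 0 < s /\ s <= d / 2 /\ s <= t / 2)
  by (repeat split; [apply Rmin_pos; lra|apply Rmin_l|apply Rmin_r]).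
(* Subtracting [e * r] makes the time derivative strictly negative. As [e * t = c / 2], the value
   left at [(x, t)] is [c / 2], still above the [c / 4] allowed initially. *)
pose (e := c / (2 * t)).
assert (He : 0 < e) by (apply Rdiv_lt_0_compat; lra).
assert (Hmp : Y x t - e * t <= c / 4).
{ apply (parabolic_max_principle (fun y r => Y y r - e * r) (- rho) rho s t (c / 4));
    try assumption; try lra.
  - intros y r Hy Hr; pose proof (Y_cont y r ltac:(lra)).
    continuity_2d; apply continuity_2d_pt_id2.
  - intros y Hy; pose proof (Hini y s Hy ltac:(lra)) as K.
    apply Rabs_def2 in K; pose proof (Rmult_lt_0_compat e s He ltac:(lra)); lra.
  - intros y r Hy Hr Hpos Hsp Htm.
    assert (HY : 0 < Y y r) by (pose proof (Rmult_lt_0_compat e r He ltac:(lra)); lra).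
    destruct (I_max_critical (fun z => u z r) (fun z => ux z r) y (uxx y r)) as [E1 E2];
      try assumption.
    + intros; apply Hux; lra.
    + apply Huxx; lra.
    + intros z Hz; specialize (Hsp z Hz); unfold Y in Hsp; lra.
    + intros ->; rewrite ux_right by lra.
      pose proof (exp_half_ge1 (Y rho r) ltac:(lra)).
      pose proof (Rmult_le_pos (- k0r) (exp (Y rho r / 2) - 1) ltac:(lra) ltac:(lra)); lra.
    + intros ->; pose proof (ux_left r ltac:(lra)) as K.
      pose proof (exp_half_ge1 (Y (- rho) r) ltac:(lra)).
      pose proof (Rmult_le_pos (- k0l) (exp (Y (- rho) r / 2) - 1) ltac:(lra) ltac:(lra)); lra.
    + assert (HD : derivable_pt_lim (fun z => Y y z - e * z) r (- scal y r - e * 1)).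
      { apply derivable_pt_lim_minus; [apply Y_derive_time; [exact Hy|lra]|].
        apply derivable_pt_lim_scal, derivable_pt_lim_id. }
      apply derive_ge0_of_left_max with (t0 := s) in HD; [|lra|exact Htm].
      rewrite scal_at_critical in HD by exact E1.
      pose proof (HR0 y Hy).
      pose proof (Rmult_le_pos (exp (-2 * u y r)) (scal0 f f2 y - 2 * uxx y r)
        ltac:(left; apply exp_pos) ltac:(lra)); lra. }
assert (e * t = c / 2) by (unfold e; field; lra).
unfold c in *; lra.
Qed.

Lemma scal_cont (x t : R) : I x -> 0 < t -> continuity_2d_pt scal x t.
Proof.
intros Hx Ht; pose proof (Hfpos x Hx).
pose proof (u_cont x t Ht); pose proof (ux_cont x t Ht); pose proof (uxx_cont x t Ht).
assert (K : continuity_2d_pt (fun y _ => / f y) x t).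
{ apply continuity_2d_pt_inv; [|lra].
  apply (continuity_2d_pt_fst f); eapply continuity_pt_of_derive, Hf1. }
unfold scal, scal_conf, scal0, Rdiv; continuity_2d.
- apply (continuity_2d_pt_fst f2), f2_cont.
- apply (continuity_2d_pt_fst f1); eapply continuity_pt_of_derive, Hf2.
Qed.

(** * Curvature bound for small times by comparison with rescaled solutions *)

Section SmallTimes.

Variables (T : R -> R) (s1 C0 : R).
Hypothesis HC0 : forall x, I x -> scal0 f f2 x <= C0.
Hypothesis C0_pos : 0 <= C0.
Hypothesis Hs1 : 0 < s1.
Hypothesis HTpos : forall s, 0 < s < s1 -> 0 < T s.
Hypothesis HTd : forall s, 0 < s < s1 -> derivable_pt_lim T s (phi (T s)).
Hypothesis HT0 : forall e, 0 < e -> exists d, 0 < d /\ forall s, 0 < s < d -> s < s1 -> T s < e.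

(** [T s] is the normalised time that corresponds to the unnormalised time [s]. Thus [- Vs] is the
    curvature of the unnormalised flow, and [lap] is the Laplacian of [u] for the initial metric. *)
Let V (x s : R) : R := Y x (T s).
Let Vs (x s : R) : R := - scal x (T s) * phi (T s).
Let lap (x s : R) : R := uxx x (T s) + f1 x / f x * ux x (T s).

Lemma T_cont (s : R) : 0 < s < s1 -> continuity_pt T s.
Proof. intros Hs; eapply continuity_pt_of_derive, HTd, Hs. Qed.

Lemma V_cont (x s : R) : 0 < s < s1 -> continuity_2d_pt V x s.
Proof.
intros Hs; apply (continuity_2d_pt_reparam Y T); [apply Y_cont, HTpos, Hs|apply T_cont, Hs].
Qed.

Lemma V_derive (x s : R) : I x -> 0 < s < s1 -> derivable_pt_lim (V x) s (Vs x s).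
Proof.
intros Hx Hs; apply (derivable_pt_lim_comp T (Y x)); [apply HTd, Hs|].
apply Y_derive_time; [exact Hx|apply HTpos, Hs].
Qed.

Lemma Vs_cont (x s : R) : I x -> 0 < s < s1 -> continuity_2d_pt Vs x s.
Proof.
intros Hx Hs.
assert (continuity_2d_pt (fun y s => scal y (T s)) x s).
{ apply (continuity_2d_pt_reparam scal T); [apply scal_cont, HTpos, Hs; exact Hx|apply T_cont, Hs]. }
assert (continuity_2d_pt (fun y s => phi (T s)) x s).
{ apply (continuity_2d_pt_snd (fun s => phi (T s))), (continuity_pt_comp T phi);
  [apply T_cont, Hs|apply phi_cont, HTpos, Hs]. }
unfold Vs; continuity_2d.
Qed.

(** The unnormalised flow as a logarithmic diffusion equation: the time derivative of [exp V] is the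
    initial Laplacian of [V] minus the initial curvature, since [V] and [2 u] differ by a function
    of time. *)
Lemma V_equation (x s : R) : 0 < s < s1 ->
  exp (V x s) * Vs x s = 2 * lap x s - scal0 f f2 x.
Proof.
intros Hs; pose proof (HTpos s Hs) as HT; pose proof (Hphipos (T s) ltac:(lra)) as Hp.
unfold V, Y, Vs, scal, scal_conf, lap.
unfold Rminus at 1; rewrite exp_plus, exp_Ropp, exp_ln by exact Hp.
replace (-2 * u x (T s)) with (- (2 * u x (T s))) by ring.
rewrite exp_Ropp; pose proof (exp_pos (2 * u x (T s))).
generalize dependent (exp (2 * u x (T s))); intros E HE.
set (g := f1 x / f x); field; lra.
Qed.

(** At a spatial minimum of [V] the boundary sign comes from [Y_nonpos], the Laplacian term is
    nonnegative, and [V_equation] bounds the decay rate of [exp V] by [C0]. *)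
Lemma V_lower (x s : R) : I x -> 0 < s < s1 -> 1 - C0 * s <= exp (V x s).
Proof.
intros Hx1 Hs; destruct (Rle_lt_dec (1 - C0 * s) (exp (V x s))) as [|Hc0]; [assumption|exfalso].
set (c := 1 - C0 * s - exp (V x s)).
assert (Hc : 0 < c) by (unfold c; lra).
destruct (Y_init (c / 4) ltac:(lra)) as [d [Hd Hini]].
destruct (HT0 d Hd) as [d' [Hd' HTd']].
pose (s0 := Rmin (d' / 2) (s / 2)).
assert (Hs0 : 0 < s0 /\ s0 <= d' / 2 /\ s0 <= s / 2)
  by (repeat split; [apply Rmin_pos; lra|apply Rmin_l|apply Rmin_r]).
pose (e := c / (2 * s)).
assert (He : 0 < e) by (apply Rdiv_lt_0_compat; lra).
assert (Hmp : 1 - exp (V x s) - (C0 + e) * s <= c / 4).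
{ apply (parabolic_max_principle (fun y r => 1 - exp (V y r) - (C0 + e) * r)
    (- rho) rho s0 s (c / 4)); try assumption; try lra.
  - intros y r Hy Hr; pose proof (V_cont y r ltac:(lra)).
    continuity_2d; apply continuity_2d_pt_id2.
  - intros y Hy.
    pose proof (Hini y (T s0) Hy (conj (HTpos s0 ltac:(lra)) (HTd' s0 ltac:(lra) ltac:(lra)))) as K.
    fold (V y s0) in K; apply Rabs_def2 in K.
    pose proof (exp_ineq1_le (V y s0)).
    pose proof (Rmult_lt_0_compat (C0 + e) s0 ltac:(lra) ltac:(lra)); lra.
  - intros y r Hy Hr _ Hsp Htm.
    pose proof (HTpos r ltac:(lra)) as HTr.
    destruct (I_max_critical (fun z => - u z (T r)) (fun z => - ux z (T r)) y (- uxx y (T r)))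
      as [E1 E2]; try assumption.
    + intros; apply derivable_pt_lim_opp, Hux; lra.
    + apply derivable_pt_lim_opp, Huxx; lra.
    + intros z Hz; specialize (Hsp z Hz).
      destruct (Rle_lt_dec (- u z (T r)) (- u y (T r))) as [|K]; [assumption|exfalso].
      assert (exp (V z r) < exp (V y r)) by (apply exp_increasing; unfold V, Y; lra); lra.
    + intros ->; rewrite ux_right by lra.
      pose proof (Y_nonpos rho (T r) Hy HTr).
      assert (exp (Y rho (T r) / 2) <= 1)
        by (apply exp_nonpos_le1; lra).
      pose proof (Rmult_le_pos (- k0r) (1 - exp (Y rho (T r) / 2)) ltac:(lra) ltac:(lra)); lra.
    + intros ->; pose proof (ux_left (T r) ltac:(lra)) as K.
      pose proof (Y_nonpos (- rho) (T r) Hy HTr).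
      assert (exp (Y (- rho) (T r) / 2) <= 1)
        by (apply exp_nonpos_le1; lra).
      pose proof (Rmult_le_pos (- k0l) (1 - exp (Y (- rho) (T r) / 2)) ltac:(lra) ltac:(lra)); lra.
    + assert (HD : derivable_pt_lim (fun z => 1 - exp (V y z) - (C0 + e) * z) r
        (0 - exp (V y r) * Vs y r - (C0 + e) * 1)).
      { apply derivable_pt_lim_minus; [apply derivable_pt_lim_minus|].
        - apply derivable_pt_lim_const.
        - apply (derivable_pt_lim_comp (V y) exp); [apply V_derive; [exact Hy|lra]|].
          apply derivable_pt_lim_exp.
        - apply derivable_pt_lim_scal, derivable_pt_lim_id. }
      apply derive_ge0_of_left_max with (t0 := s0) in HD; [|lra|exact Htm].
      rewrite V_equation in HD by lra; unfold lap in HD.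
      replace (ux y (T r)) with 0 in HD by lra.
      pose proof (HC0 y Hy); lra. }
assert (e * s = c / 2) by (unfold e; field; lra).
unfold c in *; lra.
Qed.

(* Both sides are solutions of the unnormalised flow; the left one is the
   rescaled solution [W |-> a W(s / a)], whose boundary curvature is more
   negative because [a <= 1]. *)
Lemma V_shift_comparison (h sb : R) :
  0 < h -> 0 < sb -> C0 * (sb + h) < 1 -> sb + h < s1 -> sb / (1 - C0 * h) < s1 ->
  forall x s, I x -> 0 < s <= sb ->
    V x (s / (1 - C0 * h)) + ln (1 - C0 * h) <= V x (s + h).
Proof.
intros Hh Hsb HC Hr1 Hr2 x s Hx Hs.
set (a := 1 - C0 * h) in *.
assert (Ha : 0 < a <= 1).
{ pose proof (Rmult_le_pos C0 h C0_pos ltac:(lra)).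
  pose proof (Rmult_le_pos C0 sb C0_pos ltac:(lra)). unfold a; lra. }
assert (Hsa : forall r, 0 < r <= sb -> 0 < r / a < s1).
{ intros r Hr; split; [apply Rdiv_lt_0_compat; lra|].
  eapply Rle_lt_trans; [|exact Hr2].
  apply Rmult_le_compat_r; [left; apply Rinv_0_lt_compat; lra|lra]. }
assert (Hln : ln a <= 0) by (rewrite <- ln_1; apply ln_le; lra).
(* The shift [h > 0] keeps the times [r + h] away from the initial one, so [Vs] is bounded there
   although nothing is known about it near time 0. *)
assert (HK : exists K, forall y r, I y -> 0 <= r <= sb -> Rabs (Vs y (r + h)) <= K).
{ destruct (rectangle_max (fun y r => Rabs (Vs y r)) (- rho) rho h (sb + h)) as [y0 [r0 [_ [_ Hm]]]];
    [lra|lra| |].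
  - intros y r Hy Hr; apply (continuity_1d_2d_pt_comp Rabs); [apply Rcontinuity_abs|].
    apply Vs_cont; [exact Hy|lra].
  - exists (Rabs (Vs y0 r0)); intros y r Hy Hr; apply Hm; [exact Hy|lra]. }
destruct HK as [K HK].
set (Z := fun y r => V y (r / a) + ln a - V y (r + h)).
destruct (Rle_lt_dec (Z x s) 0) as [HZ|HZ]; [unfold Z in HZ; lra|exfalso].
(* The equation for [Z] has a zeroth order term of size at most [K * Z] where [Z > 0]; the factor
   [exp (- (K + 1) * s)] absorbs it and leaves strict decay. *)
set (c := Z x s * exp (- (K + 1) * s)).
assert (Hc : 0 < c) by (apply Rmult_lt_0_compat; [exact HZ|apply exp_pos]).
assert (HK0 : 0 <= K).
{ eapply Rle_trans; [apply Rabs_pos|apply (HK x 0 Hx); lra]. }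
pose (b := 1 - C0 * (sb + h)).
assert (Hb : 0 < b) by (unfold b; lra).
(* Chosen so that [C0 * s0 / b <= c / 2], which bounds [Z] at time [s0]; [C0 + 1] avoids a division
   by zero. *)
pose (s0 := Rmin (s / 2) (c / 2 * b / (C0 + 1))).
assert (Hs0 : 0 < s0 /\ s0 <= s / 2 /\ s0 <= c / 2 * b / (C0 + 1)).
{ repeat split; [apply Rmin_pos; [lra|]|apply Rmin_l|apply Rmin_r].
  apply Rdiv_lt_0_compat; [apply Rmult_lt_0_compat|]; lra. }
assert (HZd : forall y r, I y -> 0 < r <= sb ->
  derivable_pt_lim (Z y) r (Vs y (r / a) * / a - Vs y (r + h))).
{ intros y r Hy Hr; unfold Z; apply derivable_pt_lim_minus.
  - replace (Vs y (r / a) * / a) with (Vs y (r / a) * (1 * / a) + 0) by ring.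
    apply derivable_pt_lim_plus; [|apply derivable_pt_lim_const].
    apply (derivable_pt_lim_comp (fun r => r / a) (V y)).
    + apply (derivable_pt_lim_scal_right id), derivable_pt_lim_id.
    + apply V_derive; [exact Hy|now apply Hsa].
  - replace (Vs y (r + h)) with (Vs y (r + h) * (1 + 0)) by ring.
    apply (derivable_pt_lim_comp (fun r => r + h) (V y)).
    + apply derivable_pt_lim_plus; [apply derivable_pt_lim_id|apply derivable_pt_lim_const].
    + apply V_derive; [exact Hy|lra]. }
assert (Hmp : Z x s * exp (- (K + 1) * s) <= c / 2).
{ apply (parabolic_max_principle (fun y r => Z y r * exp (- (K + 1) * r))
    (- rho) rho s0 s (c / 2)); try assumption; try lra.
  - intros y r Hy Hr.
    assert (continuity_2d_pt (fun y r => V y (r / a)) y r).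
    { apply (continuity_2d_pt_reparam V (fun r => r / a)); [apply V_cont, Hsa; lra|].
      eapply continuity_pt_of_derive, (derivable_pt_lim_scal_right id), derivable_pt_lim_id. }
    assert (continuity_2d_pt (fun y r => V y (r + h)) y r).
    { apply (continuity_2d_pt_reparam V (fun r => r + h)); [apply V_cont; lra|].
      eapply continuity_pt_of_derive, derivable_pt_lim_plus;
        [apply derivable_pt_lim_id|apply derivable_pt_lim_const]. }
    unfold Z; continuity_2d; apply continuity_2d_pt_id2.
  - intros y Hy; destruct (Rle_lt_dec (Z y s0) 0) as [HZ0|HZ0].
    + pose proof (Rmult_le_pos (- Z y s0) (exp (- (K + 1) * s0)) ltac:(lra)
        ltac:(left; apply exp_pos)); lra.
    + assert (Z y s0 <= c / 2).
      { assert (HB : V y (s0 / a) <= 0)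
          by (apply Y_nonpos; [exact Hy|apply HTpos, Hsa; lra]).
        assert (HA : a - C0 * s0 <= exp (V y (s0 + h)))
          by (unfold a; replace (1 - C0 * h - C0 * s0) with (1 - C0 * (s0 + h)) by ring;
              apply V_lower; [exact Hy|lra]).
        (* By [ln z <= z - 1] and [V_lower], the left side is at most [(a - exp V) / exp V <= C0 *
           s0 / (a - C0 * s0)], and [b] bounds the last denominator from below. *)
        assert (HE : ln a - V y (s0 + h) <= C0 * s0 / b).
        { assert (Hbb : b <= a - C0 * s0).
          { unfold a, b; pose proof (Rmult_le_compat_l C0 s0 sb C0_pos ltac:(lra)); lra. }
          assert (K1 : a * / exp (V y (s0 + h)) - 1 <= C0 * s0 / b).
          { pose proof (exp_pos (V y (s0 + h))) as Hep.
            assert (0 <= C0 * s0) by (apply Rmult_le_pos; lra).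
            replace (a * / exp (V y (s0 + h)) - 1)
              with ((a - exp (V y (s0 + h))) * / exp (V y (s0 + h))) by (field; lra).
            apply Rle_trans with (C0 * s0 * / exp (V y (s0 + h))).
            - apply Rmult_le_compat_r; [left; apply Rinv_0_lt_compat; lra|lra].
            - apply Rmult_le_compat_l; [assumption|apply Rinv_le_contravar; lra]. }
          pose proof (exp_ineq1_le (ln a - V y (s0 + h))) as K2.
          unfold Rminus in K2; rewrite exp_plus, exp_Ropp, exp_ln in K2 by lra; lra. }
        assert (C0 * s0 / b <= c / 2).
        { apply Rmult_le_reg_r with b; [exact Hb|].
          replace (C0 * s0 / b * b) with (C0 * s0) by (field; lra).
          apply Rle_trans with ((C0 + 1) * s0); [lra|].
          replace (c / 2 * b) with ((C0 + 1) * (c / 2 * b / (C0 + 1))) by (field; lra).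
          apply Rmult_le_compat_l; lra. }
        unfold Z; lra. }
      assert (exp (- (K + 1) * s0) <= 1).
      { apply exp_nonpos_le1.
        pose proof (Rmult_le_pos (K + 1) s0 ltac:(lra) ltac:(lra)); lra. }
      pose proof (Rmult_le_compat_l (Z y s0) _ 1 ltac:(lra) H0); lra.
  - intros y r Hy Hr Hpos Hsp Htm.
    assert (Hr' : 0 < r <= sb) by lra.
    pose proof (exp_pos (- (K + 1) * r)) as Hep.
    assert (HZr : 0 < Z y r).
    { destruct (Rle_lt_dec (Z y r) 0) as [J|J]; [exfalso|exact J].
      pose proof (Rmult_le_pos (- Z y r) _ ltac:(lra) (Rlt_le _ _ Hep)); lra. }
    pose proof (HTpos (r / a) (Hsa r Hr')) as HTa.
    pose proof (HTpos (r + h) ltac:(lra)) as HTh.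
    assert (HYY : Y y (T (r + h)) <= Y y (T (r / a)))
      by (unfold Z, V in HZr; lra).
    destruct (I_max_critical (fun z => u z (T (r / a)) - u z (T (r + h)))
       (fun z => ux z (T (r / a)) - ux z (T (r + h))) y
       (uxx y (T (r / a)) - uxx y (T (r + h)))) as [E1 E2]; try assumption.
    + intros; apply derivable_pt_lim_minus; apply Hux; assumption.
    + apply derivable_pt_lim_minus; apply Huxx; assumption.
    + intros z Hz; specialize (Hsp z Hz).
      apply Rmult_le_reg_r in Hsp; [|exact Hep].
      unfold Z, V, Y in Hsp; lra.
    + intros ->; rewrite !ux_right by lra.
      assert (exp (Y rho (T (r + h)) / 2) <= exp (Y rho (T (r / a)) / 2)) by (apply exp_monotone; lra).
      pose proof (Rmult_le_pos (- k0r) (exp (Y rho (T (r / a)) / 2) - exp (Y rho (T (r + h)) / 2))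
        ltac:(lra) ltac:(lra)); lra.
    + intros ->.
      pose proof (ux_left (T (r + h)) HTh); pose proof (ux_left (T (r / a)) HTa).
      assert (exp (Y (- rho) (T (r + h)) / 2) <= exp (Y (- rho) (T (r / a)) / 2)) by (apply exp_monotone; lra).
      pose proof (Rmult_le_pos (- k0l) (exp (Y (- rho) (T (r / a)) / 2) - exp (Y (- rho) (T (r + h)) / 2))
        ltac:(lra) ltac:(lra)); lra.
    + assert (HD : derivable_pt_lim (fun z => Z y z * exp (- (K + 1) * z)) r
        ((Vs y (r / a) * / a - Vs y (r + h)) * exp (- (K + 1) * r)
         + Z y r * (exp (- (K + 1) * r) * (- (K + 1) * 1)))).
      { apply (derivable_pt_lim_mult (Z y) (fun z => exp (- (K + 1) * z))); [now apply HZd|].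
        apply (derivable_pt_lim_comp (fun z => - (K + 1) * z) exp).
        - apply derivable_pt_lim_scal, derivable_pt_lim_id.
        - apply derivable_pt_lim_exp. }
      apply derive_ge0_of_left_max with (t0 := s0) in HD; [|lra|exact Htm].
      pose proof (V_equation y (r / a) (Hsa r Hr')) as Q1.
      pose proof (V_equation y (r + h) ltac:(lra)) as Q2.
      assert (Q3 : exp (V y (r / a)) * Vs y (r / a) <= exp (V y (r + h)) * Vs y (r + h)).
      { rewrite Q1, Q2; unfold lap.
        replace (ux y (T (r / a))) with (ux y (T (r + h))) by lra; lra. }
      (* Divide [Q3] by [a * exp (V y (r / a))]; the quotient of the exponentials is exactly
         [exp (- Z y r)]. *)
      assert (Q4 : Vs y (r / a) * / a <= exp (- Z y r) * Vs y (r + h)).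
      { apply Rmult_le_reg_l with (a * exp (V y (r / a))).
        - apply Rmult_lt_0_compat; [lra|apply exp_pos].
        - replace (- Z y r) with (V y (r + h) + (- V y (r / a) + - ln a)) by (unfold Z; ring).
          rewrite !exp_plus, !exp_Ropp, exp_ln by lra.
          pose proof (exp_pos (V y (r / a))).
          replace (a * exp (V y (r / a)) * (Vs y (r / a) * / a))
            with (exp (V y (r / a)) * Vs y (r / a)) by (field; lra).
          replace (a * exp (V y (r / a)) * (exp (V y (r + h)) * (/ exp (V y (r / a)) * / a) * Vs y (r + h)))
            with (exp (V y (r + h)) * Vs y (r + h)) by (field; lra).
          exact Q3. }
      pose proof (HK y r Hy ltac:(lra)) as HK1; apply Rabs_le_between in HK1.
      pose proof (exp_ineq1_le (- Z y r)) as Q5.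
      assert (Q6 : exp (- Z y r) <= 1) by (apply exp_nonpos_le1; lra).
      assert (Q7 : (exp (- Z y r) - 1) * Vs y (r + h) <= K * Z y r).
      { apply Rle_trans with ((1 - exp (- Z y r)) * K).
        - replace ((exp (- Z y r) - 1) * Vs y (r + h))
            with ((1 - exp (- Z y r)) * (- Vs y (r + h))) by ring.
          apply Rmult_le_compat_l; lra.
        - rewrite (Rmult_comm K); apply Rmult_le_compat_r; lra. }
      assert (HD' : 0 <= (Vs y (r / a) * / a - Vs y (r + h) - (K + 1) * Z y r) * exp (- (K + 1) * r))
        by lra.
      assert (Q8 : Vs y (r / a) * / a - Vs y (r + h) - (K + 1) * Z y r < 0) by lra.
      pose proof (Rmult_lt_0_compat _ _ (Ropp_0_gt_lt_contravar _ Q8) Hep); lra. }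
fold c in Hmp; lra.
Qed.

(** Put [k = - h] in [V_shift_comparison]: the difference of its two sides, as a function of
    [k <= 0], is maximal at [k = 0], where it vanishes. Its derivative there gives
    [0 <= Vs * (1 - C0 * s) + C0]. *)
Lemma Vs_lower (x s : R) : I x -> 0 < s < s1 -> C0 * s <= 1 / 2 -> - Vs x s <= 2 * C0.
Proof.
intros Hx Hs HC.
(* The first bound keeps [s + h] and [s / (1 - C0 * h)] below [s1]; the second gives
   [C0 * (s + h) < 1]. *)
pose (h0 := Rmin ((s1 - s) / 2 / (s1 * C0 + 1)) (/ (4 * (C0 + 1)))).
pose proof (Rmult_le_pos s1 C0 ltac:(lra) C0_pos) as Hsc.
assert (Hh0 : 0 < h0 /\ h0 * (s1 * C0 + 1) <= (s1 - s) / 2 /\ h0 * (C0 + 1) <= 1 / 4).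
{ repeat split.
  - apply Rmin_pos; [apply Rdiv_lt_0_compat; lra|apply Rinv_0_lt_compat; lra].
  - apply Rle_trans with ((s1 - s) / 2 / (s1 * C0 + 1) * (s1 * C0 + 1)).
    + apply Rmult_le_compat_r; [lra|apply Rmin_l].
    + right; field; lra.
  - apply Rle_trans with (/ (4 * (C0 + 1)) * (C0 + 1)).
    + apply Rmult_le_compat_r; [lra|apply Rmin_r].
    + right; field; lra. }
destruct Hh0 as [Hh0 [Hh1 Hh2]].
assert (HD : derivable_pt_lim (fun k => V x (s / (1 + C0 * k)) + ln (1 + C0 * k) - V x (s - k)) 0
   (Vs x s * (- s * C0) + C0 - Vs x s * (- 1))).
{ assert (D1 : derivable_pt_lim (fun k => 1 + C0 * k) 0 (0 + C0 * 1)).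
  { apply derivable_pt_lim_plus; [apply derivable_pt_lim_const|].
    apply derivable_pt_lim_scal, derivable_pt_lim_id. }
  replace (0 + C0 * 1) with C0 in D1 by ring.
  apply derivable_pt_lim_minus; [apply derivable_pt_lim_plus|].
  - apply (derivable_pt_lim_comp (fun k => s / (1 + C0 * k)) (V x)).
    + replace (- s * C0) with ((0 * (1 + C0 * 0) - C0 * s) / Rsqr (1 + C0 * 0))
        by (unfold Rsqr; field; lra).
      apply (derivable_pt_lim_div (fun _ => s) (fun k => 1 + C0 * k)); [apply derivable_pt_lim_const|exact D1|lra].
    + replace (s / (1 + C0 * 0)) with s by (field; lra).
      apply V_derive; assumption.
  - pose proof (derivable_pt_lim_comp (fun k => 1 + C0 * k) ln 0 _ _ D1
      (derivable_pt_lim_ln (1 + C0 * 0) ltac:(lra))) as D2.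
    replace (/ (1 + C0 * 0) * C0) with C0 in D2 by (field; lra); exact D2.
  - apply (derivable_pt_lim_comp (fun k => s - k) (V x)).
    + replace (- 1) with (0 - 1) by ring.
      apply derivable_pt_lim_minus; [apply derivable_pt_lim_const|apply derivable_pt_lim_id].
    + rewrite Rminus_0_r; apply V_derive; assumption. }
apply derive_ge0_of_left_max with (t0 := - h0) in HD; [|lra|].
- assert (0 <= Vs x s * (1 - C0 * s) + C0) as HD' by lra.
  destruct (Rle_lt_dec (- Vs x s) (2 * C0)) as [|J]; [assumption|exfalso].
  pose proof (Rmult_le_compat_l (- Vs x s) (1 / 2) (1 - C0 * s) ltac:(lra) ltac:(lra)); lra.
- intros k Hk.
  replace (s / (1 + C0 * 0)) with s by (field; lra).
  rewrite Rmult_0_r, Rplus_0_r, ln_1, Rminus_0_r.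
  destruct (Req_dec k 0) as [->|Hk0].
  + replace (s / (1 + C0 * 0)) with s by (field; lra).
    rewrite Rmult_0_r, Rplus_0_r, ln_1, Rminus_0_r; lra.
  + assert (Hk2 : - k <= h0) by lra.
    pose proof (Rmult_le_compat_r (s1 * C0 + 1) _ _ ltac:(lra) Hk2).
    pose proof (Rmult_le_compat_r (C0 + 1) _ _ ltac:(lra) Hk2).
    pose proof (Rmult_le_pos (- k) (s1 * C0) ltac:(lra) Hsc).
    pose proof (Rmult_le_pos (- k) C0 ltac:(lra) C0_pos).
    pose proof (V_shift_comparison (- k) s ltac:(lra) ltac:(lra) ltac:(lra) ltac:(lra)) as K.
    replace (1 - C0 * - k) with (1 + C0 * k) in K by ring.
    specialize (fun J => K J x s Hx ltac:(lra)).
    assert (Hsk : s / (1 + C0 * k) < s1).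
    { apply Rmult_lt_reg_r with (1 + C0 * k); [lra|].
      replace (s / (1 + C0 * k) * (1 + C0 * k)) with s by (field; lra); lra. }
    specialize (K Hsk); replace (s + - k) with (s - k) in K by ring; lra.
Qed.

End SmallTimes.

Lemma scal_bounded_small_times : exists t1 C, 0 < t1 /\
  forall x t, I x -> 0 < t <= t1 -> scal x t <= C.
Proof.
destruct (continuity_ab_maj (scal0 f f2) (- rho) rho) as [xm [Hxm Hxm']]; [lra| |].
{ intros x Hx; pose proof (Hfpos x Hx) as K.
  apply (continuity_pt_mult (fun y => -2 * f2 y) (fun y => / f y)).
  - apply (continuity_pt_scal f2), f2_cont.
  - apply (continuity_pt_inv f); [eapply continuity_pt_of_derive, Hf1|lra]. }
set (C0 := scal0 f f2 xm).
assert (HC0 : 0 <= C0) by (apply HR0, Hxm').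
assert (Hmax : forall t, 0 <= Rmax 0 t) by (intros; apply Rmax_l).
(* [phi] is extended to negative times by its initial value, to have a continuous positive integrand
   on the whole line. *)
destruct (time_change (fun t => / phi (Rmax 0 t))) as [T [s1 [Hs1 [HTd [HT0 HTs]]]]].
{ intros t.
  assert (Hpc : continuity_pt (fun t => phi (Rmax 0 t)) t).
  { destruct (Rtotal_order t 0) as [Ht|[->|Ht]].
    - apply continuity_pt_ext_loc with (fun _ => 1).
      + exists (mkposreal (- t) ltac:(lra)); intros y Hy.
        apply Rabs_def2 in Hy; simpl in Hy; unfold minus, plus, opp in Hy; simpl in Hy.
        rewrite Rmax_left by lra; now symmetry.
      + apply continuity_pt_const; now intros ? ?.
    - intros eps Heps; destruct (Hphic eps Heps) as [d [Hd H]].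
      exists d; split; [exact Hd|]; intros y [_ Hy].
      simpl in *; unfold R_dist in *; rewrite (Rmax_left 0 0), Hphi0 by lra.
      apply Rabs_def2 in Hy; destruct (Rle_lt_dec y 0).
      + rewrite Rmax_left, Hphi0, Rminus_diag, Rabs_R0 by lra; lra.
      + rewrite Rmax_right by lra; apply H; lra.
    - apply continuity_pt_ext_loc with phi.
      + exists (mkposreal t Ht); intros y Hy.
        apply Rabs_def2 in Hy; simpl in Hy; unfold minus, plus, opp in Hy; simpl in Hy.
        rewrite Rmax_right by lra; reflexivity.
      + now apply phi_cont. }
  apply continuity_pt_filterlim, (continuity_pt_inv (fun t => phi (Rmax 0 t))); [exact Hpc|].
  pose proof (Hphipos _ (Hmax t)); lra. }
{ intros t; apply Rinv_0_lt_compat, Hphipos, Hmax. }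
assert (HTpos : forall s, 0 < s < s1 -> 0 < T s) by (intros; now apply HTd).
assert (HTd' : forall s, 0 < s < s1 -> derivable_pt_lim T s (phi (T s))).
{ intros s Hs; destruct (HTd s Hs) as [K1 K2].
  rewrite Rinv_inv, Rmax_right in K2 by lra; exact K2. }
destruct (Hphic (1 / 2) ltac:(lra)) as [d [Hd Hphi]].
pose (sb := Rmin (s1 / 2) (/ (2 * (C0 + 1)))).
assert (Hsb : 0 < sb /\ sb <= s1 / 2 /\ sb * (C0 + 1) <= 1 / 2).
{ repeat split; [apply Rmin_pos; [lra|apply Rinv_0_lt_compat; lra]|apply Rmin_l|].
  apply Rle_trans with (/ (2 * (C0 + 1)) * (C0 + 1)).
  - apply Rmult_le_compat_r; [lra|apply Rmin_r].
  - right; field; lra. }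
destruct Hsb as [Hsb1 [Hsb2 Hsb3]].
pose proof (HTpos sb ltac:(lra)) as HTsb.
(* The three bounds ensure, in this order, that the matching [s] is at most [sb], that
   [phi > 1 / 2], and that [t] is in the range of [T]. Since [- Vs = scal * phi <= 2 * C0], the
   constant is [4 * C0]. *)
pose (t1 := Rmin (T sb) (Rmin (d / 2) (1 / 2))).
assert (Ht1 : 0 < t1 /\ t1 <= T sb /\ t1 <= d / 2 /\ t1 <= 1 / 2).
{ pose proof (Rmin_l (T sb) (Rmin (d / 2) (1 / 2))).
  pose proof (Rmin_r (T sb) (Rmin (d / 2) (1 / 2))).
  pose proof (Rmin_l (d / 2) (1 / 2)); pose proof (Rmin_r (d / 2) (1 / 2)).
  split; [apply Rmin_pos; [lra|apply Rmin_pos; lra]|unfold t1; lra]. }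
exists t1, (4 * C0); split; [lra|]; intros x t Hx Ht.
destruct (HTs t ltac:(lra)) as [s [Hs Est]].
assert (Hss : s <= sb).
{ destruct (Rle_lt_dec s sb) as [|K]; [assumption|exfalso].
  destruct (MVT_cor2 T (fun s => phi (T s)) sb s K) as [y [E Hy]];
    [intros; apply HTd'; lra|].
  pose proof (Rmult_lt_0_compat _ (s - sb)
    (Hphipos (T y) (Rlt_le _ _ (HTpos y ltac:(lra)))) ltac:(lra)); lra. }
assert (HCs : C0 * s <= 1 / 2).
{ pose proof (Rmult_le_compat_r C0 s sb HC0 Hss); lra. }
pose proof (Vs_lower T s1 C0 Hxm HC0 Hs1 HTpos HTd' HT0 x s Hx Hs HCs) as K.
cbv beta zeta in K; rewrite Est in K.
pose proof (Hphi t ltac:(lra)) as Hp; apply Rabs_def2 in Hp.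
destruct (Rle_lt_dec (scal x t) (4 * C0)) as [|J]; [assumption|exfalso].
pose proof (Rmult_lt_compat_l (scal x t) (1 / 2) (phi t) ltac:(lra) ltac:(lra)); lra.
Qed.

(** * Curvature bound away from the initial time *)

Hypothesis Harea : forall t, 0 < t ->
  exists pr : Riemann_integrable (fun x => 2 * PI * exp (2 * u x t) * f x) (- rho) rho,
    RiemannInt pr = 1.

(* In the coordinate [y], [dy = dr / f], the metric is [w (dy^2 + dtheta^2)],
   [q] is the derivative of [ln w] and [P = w R] is minus the derivative of [q]. *)
Let w (x t : R) : R := f x * f x * exp (2 * u x t).
Let q (x t : R) : R := 2 * (f x * ux x t + f1 x).
Let P (x t : R) : R := - 2 * f x * (f1 x * ux x t + f x * uxx x t + f2 x).
Let H (x t : R) : R := P x t + q x t * q x t / 2.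

Lemma w_pos (x t : R) : I x -> 0 < w x t.
Proof.
intros Hx; pose proof (Hfpos x Hx).
apply Rmult_lt_0_compat; [now apply Rmult_lt_0_compat|apply exp_pos].
Qed.

Lemma P_eq_w_scal (x t : R) : I x -> P x t = w x t * scal x t.
Proof.
intros Hx; pose proof (Hfpos x Hx).
unfold P, w, scal, scal_conf, scal0.
replace (-2 * u x t) with (- (2 * u x t)) by ring.
rewrite exp_Ropp; pose proof (exp_pos (2 * u x t)); field; lra.
Qed.

Lemma q_derive_space (x t : R) : 0 < t ->
  derivable_pt_lim (fun y => q y t) x (2 * (f1 x * ux x t + f x * uxx x t + f2 x)).
Proof.
intros Ht; apply (derivable_pt_lim_scal (fun y => f y * ux y t + f1 y)).
apply (derivable_pt_lim_plus (fun y => f y * ux y t) f1); [|apply Hf2].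
apply (derivable_pt_lim_mult f (fun y => ux y t)); [apply Hf1|now apply Huxx].
Qed.

Lemma w_derive_space (x t : R) : 0 < t ->
  derivable_pt_lim (fun y => w y t) x (f x * q x t * exp (2 * u x t)).
Proof.
intros Ht.
replace (f x * q x t * exp (2 * u x t))
  with ((f1 x * f x + f x * f1 x) * exp (2 * u x t)
        + f x * f x * (exp (2 * u x t) * (2 * ux x t))) by (unfold q; ring).
apply (derivable_pt_lim_mult (fun y => f y * f y) (fun y => exp (2 * u y t))).
- apply (derivable_pt_lim_mult f f); apply Hf1.
- apply (derivable_pt_lim_comp (fun y => 2 * u y t) exp).
  + now apply derivable_pt_lim_scal, Hux.
  + apply derivable_pt_lim_exp.
Qed.

(** As [d/dy = f d/dx] and [R_x = - 2 u_xt], the right-hand side is [R_yy - q R_y]. *)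
Lemma H_derive_time (x t : R) : 0 < t ->
  derivable_pt_lim (H x) t
    (- 2 * f x * (f1 x * uxt x t + f x * uxxt x t) + 2 * f x * q x t * uxt x t).
Proof.
intros Ht.
replace (- 2 * f x * (f1 x * uxt x t + f x * uxxt x t) + 2 * f x * q x t * uxt x t)
  with (- 2 * f x * (f1 x * uxt x t + f x * uxxt x t + 0)
        + (2 * (f x * uxt x t + 0) * q x t + q x t * (2 * (f x * uxt x t + 0))) / 2) by field.
assert (Dq : derivable_pt_lim (q x) t (2 * (f x * uxt x t + 0))).
{ apply derivable_pt_lim_scal, derivable_pt_lim_plus; [|apply derivable_pt_lim_const].
  now apply derivable_pt_lim_scal, Huxt. }
apply (derivable_pt_lim_plus (P x)).
- apply derivable_pt_lim_scal, derivable_pt_lim_plus; [|apply derivable_pt_lim_const].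
  apply derivable_pt_lim_plus; apply derivable_pt_lim_scal; [now apply Huxt|now apply Huxxt].
- now apply derivable_pt_lim_div_scal, (derivable_pt_lim_mult (q x) (q x)).
Qed.

(** Trading curvature for [ut] lets [H] be differentiated in space through [uxt], without a third
    space derivative of [u]. *)
Lemma H_eq_flow (x t : R) : I x -> 0 < t ->
  H x t = w x t * (rbar t - 2 * ut x t) + q x t * q x t / 2.
Proof.
intros Hx Ht; unfold H; rewrite P_eq_w_scal by exact Hx.
rewrite Hflow by assumption; ring.
Qed.

(* [H_y = w R_y], and [R_x = - 2 u_xt] by the flow equation. *)
Lemma H_derive_space (x t : R) : I x -> 0 < t ->
  derivable_pt_lim (fun y => w y t * (rbar t - 2 * ut y t) + q y t * q y t / 2) x
    (-2 * (w x t * uxt x t)).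
Proof.
intros Hx Ht; pose proof (Hfpos x Hx).
pose proof (P_eq_w_scal x t Hx) as E.
replace (scal x t) with (rbar t - 2 * ut x t) in E by (rewrite Hflow by assumption; ring).
replace (-2 * (w x t * uxt x t)) with
  ((f x * q x t * exp (2 * u x t)) * (rbar t - 2 * ut x t) + w x t * (0 - 2 * uxt x t)
   + ((2 * (f1 x * ux x t + f x * uxx x t + f2 x)) * q x t
      + q x t * (2 * (f1 x * ux x t + f x * uxx x t + f2 x))) / 2).
- apply derivable_pt_lim_plus.
  + apply (derivable_pt_lim_mult (fun y => w y t) (fun y => rbar t - 2 * ut y t));
      [now apply w_derive_space|].
    apply derivable_pt_lim_minus; [apply derivable_pt_lim_const|].
    now apply derivable_pt_lim_scal, Hutx.
  + apply derivable_pt_lim_div_scal.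
    apply (derivable_pt_lim_mult (fun y => q y t) (fun y => q y t)); now apply q_derive_space.
- apply Rmult_eq_reg_l with (f x); [|lra].
  replace (f x * (f x * q x t * exp (2 * u x t) * (rbar t - 2 * ut x t) +
     w x t * (0 - 2 * uxt x t) +
     (2 * (f1 x * ux x t + f x * uxx x t + f2 x) * q x t +
      q x t * (2 * (f1 x * ux x t + f x * uxx x t + f2 x))) / 2))
    with (q x t * (w x t * (rbar t - 2 * ut x t)) - 2 * f x * w x t * uxt x t - q x t * P x t)
    by (unfold P, w; field).
  rewrite E; ring.
Qed.

(** The time derivative of [ux_right], with [Y_t = - scal]. It gives the outward derivative of [H]
    the sign of [k0r * scal]. *)
Lemma uxt_right (t : R) : 0 < t ->
  uxt rho t = k0r * (exp (Y rho t / 2) * (- scal rho t / 2)).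
Proof.
intros Ht; assert (Hx : I rho) by (unfold I; lra).
apply (derive_unique_on_interval (ux rho) (fun t => k0r * (exp (Y rho t / 2) - 1)) (t / 2) (2 * t) t);
  [lra|lra| |now apply Huxt|].
- intros s Hs; apply ux_right; lra.
- replace (exp (Y rho t / 2) * (- scal rho t / 2))
    with (exp (Y rho t / 2) * (- scal rho t / 2) - 0) by ring.
  apply derivable_pt_lim_scal, derivable_pt_lim_minus; [|apply derivable_pt_lim_const].
  apply (derivable_pt_lim_comp (fun t => Y rho t / 2) exp).
  + apply derivable_pt_lim_div_scal; now apply Y_derive_time.
  + apply derivable_pt_lim_exp.
Qed.

Lemma uxt_left (t : R) : 0 < t ->
  - uxt (- rho) t = k0l * (exp (Y (- rho) t / 2) * (- scal (- rho) t / 2)).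
Proof.
intros Ht; assert (Hx : I (- rho)) by (unfold I; lra).
apply (derive_unique_on_interval (fun t => - ux (- rho) t)
  (fun t => k0l * (exp (Y (- rho) t / 2) - 1)) (t / 2) (2 * t) t);
  [lra|lra| |now apply derivable_pt_lim_opp, Huxt|].
- intros s Hs; apply ux_left; lra.
- replace (exp (Y (- rho) t / 2) * (- scal (- rho) t / 2))
    with (exp (Y (- rho) t / 2) * (- scal (- rho) t / 2) - 0) by ring.
  apply derivable_pt_lim_scal, derivable_pt_lim_minus; [|apply derivable_pt_lim_const].
  apply (derivable_pt_lim_comp (fun t => Y (- rho) t / 2) exp).
  + apply derivable_pt_lim_div_scal; now apply Y_derive_time.
  + apply derivable_pt_lim_exp.
Qed.

(** On the boundary [q = 2 f1 exp (Y / 2)] by the Robin condition, and [Y <= 0]. *)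
Lemma q_boundary (x t : R) : x = rho \/ x = - rho -> 0 < t ->
  q x t * q x t <= 4 * (f1 x * f1 x).
Proof.
intros Hx Ht.
assert (HI : I x) by (unfold I; destruct Hx; subst; lra).
pose proof (Hfpos x HI) as Hf.
assert (E : q x t = 2 * f1 x * exp (Y x t / 2)).
{ unfold q; destruct Hx as [->| ->].
  - rewrite ux_right by exact Ht; unfold k0r, geod0_right; field; lra.
  - replace (ux (- rho) t) with (- (- ux (- rho) t)) by ring.
    rewrite ux_left by exact Ht; unfold k0l, geod0_left; field; lra. }
pose proof (Y_nonpos x t HI Ht).
assert (K : exp (Y x t / 2) * exp (Y x t / 2) <= 1)
  by (rewrite <- exp_plus; apply exp_nonpos_le1; lra).
rewrite E.
replace (2 * f1 x * exp (Y x t / 2) * (2 * f1 x * exp (Y x t / 2)))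
  with (4 * (f1 x * f1 x) * (exp (Y x t / 2) * exp (Y x t / 2))) by ring.
pose proof (Rle_0_sqr (f1 x)) as K2; unfold Rsqr in K2.
pose proof (Rmult_le_compat_l (4 * (f1 x * f1 x)) _ _ ltac:(lra) K); lra.
Qed.

Lemma H_cont (x t : R) : 0 < t -> continuity_2d_pt H x t.
Proof.
intros Ht; pose proof (ux_cont x t Ht); pose proof (uxx_cont x t Ht).
assert (continuity_2d_pt (fun y _ => f y) x t)
  by (apply continuity_2d_pt_fst; eapply continuity_pt_of_derive, Hf1).
assert (continuity_2d_pt (fun y _ => f1 y) x t)
  by (apply continuity_2d_pt_fst; eapply continuity_pt_of_derive, Hf2).
assert (continuity_2d_pt (fun y _ => f2 y) x t) by apply continuity_2d_pt_fst, f2_cont.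
unfold H, P, q, Rdiv; continuity_2d.
Qed.

Lemma scal_pos_of_H_large (x t : R) : x = rho \/ x = - rho -> 0 < t ->
  2 * (f1 x * f1 x) < H x t -> 0 < scal x t.
Proof.
intros Hx Ht HH; pose proof (q_boundary x t Hx Ht).
assert (HI : I x) by (unfold I; destruct Hx; subst; lra).
unfold H in HH; rewrite P_eq_w_scal in HH by exact HI.
pose proof (w_pos x t HI).
apply Rmult_lt_reg_l with (w x t); lra.
Qed.

(** On the boundary [H > M] forces positive curvature, so the outward derivative of [H] is
    nonpositive. At a spatial maximum [H_y = w R_y] then vanishes, whence [R_y = 0],
    [H_yy = w R_yy <= 0] and [H_t = R_yy <= 0]. *)
Lemma H_bounded (t1 M : R) : 0 < t1 ->
  (forall x, I x -> H x t1 <= M) ->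
  2 * (f1 rho * f1 rho) <= M -> 2 * (f1 (- rho) * f1 (- rho)) <= M ->
  forall x t, I x -> t1 <= t -> H x t <= M.
Proof.
intros Ht1 HM Mr Ml x t Hx Ht.
destruct (Rle_lt_dec (H x t) M) as [|Hc]; [assumption|exfalso].
assert (t1 < t) by (destruct (Req_dec t1 t) as [<-|]; [pose proof (HM x Hx)|]; lra).
pose (e := (H x t - M) / (2 * (t - t1))).
assert (He : 0 < e) by (apply Rdiv_lt_0_compat; lra).
assert (Hmp : H x t - e * (t - t1) <= M).
{ apply (parabolic_max_principle (fun y r => H y r - e * (r - t1)) (- rho) rho t1 t M);
    try assumption; try lra.
  - intros y r Hy Hr; pose proof (H_cont y r ltac:(lra)).
    continuity_2d; apply continuity_2d_pt_id2.
  - intros y Hy; pose proof (HM y Hy); lra.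
  - intros y r Hy Hr Hpos Hsp Htm.
    pose proof (Rmult_lt_0_compat e (r - t1) He ltac:(lra)) as Her.
    assert (Hr0 : 0 < r) by lra.
    destruct (I_max_critical (fun z => w z r * (rbar r - 2 * ut z r) + q z r * q z r / 2)
       (fun z => -2 * (w z r * uxt z r)) y
       (-2 * (f y * q y r * exp (2 * u y r) * uxt y r + w y r * uxxt y r))) as [E1 E2];
      try assumption.
    + intros; now apply H_derive_space.
    + apply derivable_pt_lim_scal.
      apply (derivable_pt_lim_mult (fun z => w z r) (fun z => uxt z r));
        [now apply w_derive_space|now apply Huxtx].
    + intros z Hz; rewrite <- !H_eq_flow by assumption; specialize (Hsp z Hz); lra.
    + intros ->; rewrite uxt_right by exact Hr0.
      pose proof (scal_pos_of_H_large rho r ltac:(now left) Hr0 ltac:(lra)) as Hs.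
      pose proof (Rmult_le_pos (exp (Y rho r / 2)) (scal rho r) ltac:(left; apply exp_pos) ltac:(lra)) as K1.
      pose proof (Rmult_le_pos (- k0r) _ ltac:(lra) K1) as K2.
      pose proof (Rmult_le_pos (w rho r) _ ltac:(left; now apply w_pos) K2); lra.
    + intros ->.
      pose proof (uxt_left r Hr0) as K.
      pose proof (scal_pos_of_H_large (- rho) r ltac:(now right) Hr0 ltac:(lra)) as Hs.
      pose proof (Rmult_le_pos (exp (Y (- rho) r / 2)) (scal (- rho) r) ltac:(left; apply exp_pos) ltac:(lra)) as K1.
      pose proof (Rmult_le_pos (- k0l) _ ltac:(lra) K1) as K2.
      pose proof (Rmult_le_pos (w (- rho) r) (- uxt (- rho) r) ltac:(left; now apply w_pos) ltac:(lra)); lra.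
    + pose proof (w_pos y r Hy) as Hw.
      assert (E3 : uxt y r = 0) by (apply Rmult_eq_reg_l with (w y r); lra).
      rewrite E3 in E2.
      assert (E4 : 0 <= uxxt y r) by (apply Rmult_le_reg_l with (w y r); lra).
      pose proof (H_derive_time y r Hr0) as HD0; rewrite E3 in HD0.
      assert (HD : derivable_pt_lim (fun z => H y z - e * (z - t1)) r
        (- 2 * f y * (f1 y * 0 + f y * uxxt y r) + 2 * f y * q y r * 0 - e * (1 - 0))).
      { apply (derivable_pt_lim_minus (H y)); [exact HD0|].
        apply derivable_pt_lim_scal, derivable_pt_lim_minus;
          [apply derivable_pt_lim_id|apply derivable_pt_lim_const]. }
      apply derive_ge0_of_left_max with (t0 := t1) in HD; [|lra|exact Htm].
      pose proof (Hfpos y Hy) as Hf.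
      pose proof (Rmult_le_pos (f y * f y) _ ltac:(left; now apply Rmult_lt_0_compat) E4); lra. }
assert (e * (t - t1) = (H x t - M) / 2) by (unfold e; field; lra).
lra.
Qed.

(** Where [q] exceeds [Q] in absolute value, [q_y = q^2 / 2 - H] is positive. The upper bound
    therefore propagates leftwards from [rho], and the lower bound rightwards from [- rho]. *)
Lemma q_bounded (M Q t : R) : 0 < t -> 0 <= Q -> 2 * M <= Q * Q ->
  (forall x, I x -> H x t <= M) ->
  q rho t * q rho t <= Q * Q -> q (- rho) t * q (- rho) t <= Q * Q ->
  forall x, I x -> - Q <= q x t <= Q.
Proof.
intros Ht HQ HM HH Hr Hl x Hx.
assert (Hd : forall y, I y -> Q * Q < q y t * q y t ->
   0 < 2 * (f1 y * ux y t + f y * uxx y t + f2 y)).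
{ intros y Hy Hq; specialize (HH y Hy); unfold H, P in HH.
  pose proof (Hfpos y Hy); apply Rmult_lt_reg_l with (f y); lra. }
assert (Hsq : forall z, z * z <= Q * Q -> - Q <= z <= Q).
{ intros z Hz; split; apply Rnot_lt_le; intros K.
  - pose proof (Rmult_le_0_lt_compat Q (- z) Q (- z) HQ HQ ltac:(lra) ltac:(lra)); lra.
  - pose proof (Rmult_le_0_lt_compat Q z Q z HQ HQ K K); lra. }
apply Hsq in Hr; apply Hsq in Hl.
split.
(* The map from [y] to [- q (- y) t] turns the lower bound into an upper one. *)
- enough (- q (- - x) t <= Q) by (rewrite Ropp_involutive in *; lra).
  apply (le_of_increasing_above (fun y => - q (- y) t)
    (fun y => - ((2 * (f1 (- y) * ux (- y) t + f (- y) * uxx (- y) t + f2 (- y))) * - 1)) (- rho) rho);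
    [lra| |lra| |unfold I in Hx; lra].
  + intros y Hy; apply derivable_pt_lim_opp.
    apply (derivable_pt_lim_comp Ropp (fun y => q y t)); [|now apply q_derive_space].
    apply (derivable_pt_lim_opp id), derivable_pt_lim_id.
  + intros y Hy K; specialize (Hd (- y) ltac:(unfold I; lra)).
    pose proof (Rmult_le_0_lt_compat Q (- q (- y) t) Q (- q (- y) t) HQ HQ K K); lra.
- apply (le_of_increasing_above (fun y => q y t)
    (fun y => 2 * (f1 y * ux y t + f y * uxx y t + f2 y)) (- rho) rho);
    [lra| |lra| |exact Hx].
  + intros y Hy; now apply q_derive_space.
  + intros y Hy K; apply Hd; [exact Hy|].
    exact (Rmult_le_0_lt_compat Q (q y t) Q (q y t) HQ HQ K K).
Qed.

(** Here [L = ln w] has space derivative [q / f], at most [Q / m] in size, on an interval of length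
    [2 * rho]. *)
Lemma w_harnack (m Q t : R) : 0 < t -> 0 < m -> 0 <= Q -> (forall x, I x -> m <= f x) ->
  (forall x, I x -> - Q <= q x t <= Q) ->
  forall x y, I x -> I y -> w y t * exp (- (2 * rho * Q / m)) <= w x t.
Proof.
intros Ht Hm HQ Hf Hq x y Hx Hy.
pose (L := fun z => 2 * (u z t + ln (f z))).
assert (HL : forall z, I z -> w z t = exp (L z)).
{ intros z Hz; specialize (Hf z Hz); unfold L, w.
  replace (2 * (u z t + ln (f z))) with (ln (f z) + ln (f z) + 2 * u z t) by ring.
  rewrite !exp_plus, exp_ln by lra; reflexivity. }
assert (HLd : forall z, I z -> derivable_pt_lim L z (q z t / f z)).
{ intros z Hz; specialize (Hf z Hz).
  replace (q z t / f z) with (2 * (ux z t + / f z * f1 z)) by (unfold q; field; lra).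
  apply (derivable_pt_lim_scal (fun z => u z t + ln (f z))).
  apply (derivable_pt_lim_plus (fun z => u z t) (fun z => ln (f z))); [now apply Hux|].
  apply (derivable_pt_lim_comp f ln); [apply Hf1|apply derivable_pt_lim_ln; lra]. }
assert (Hb : forall z, I z -> Rabs (q z t / f z) <= Q / m).
{ intros z Hz; specialize (Hf z Hz); specialize (Hq z Hz).
  unfold Rdiv; rewrite Rabs_mult, (Rabs_pos_eq (/ f z))
    by (left; apply Rinv_0_lt_compat; lra).
  apply Rmult_le_compat; [apply Rabs_pos|left; apply Rinv_0_lt_compat; lra| |].
  - apply Rabs_le; lra.
  - apply Rinv_le_contravar; lra. }
assert (HQm : 0 <= Q / m) by (apply Rmult_le_pos; [|left; apply Rinv_0_lt_compat]; lra).
assert (Hosc : forall a b, I a -> I b -> a < b -> Rabs (L b - L a) <= Q / m * (2 * rho)).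
{ intros a b Ha Hb' Hab; unfold I in *.
  destruct (MVT_cor2 L (fun z => q z t / f z) a b Hab) as [z [E Hz]];
    [intros; apply HLd; unfold I; lra|].
  rewrite E, Rabs_mult, (Rabs_pos_eq (b - a)) by lra.
  apply Rmult_le_compat; [apply Rabs_pos|lra|apply Hb; unfold I; lra|lra]. }
rewrite !HL, <- exp_plus by assumption; apply exp_monotone.
replace (2 * rho * Q / m) with (Q / m * (2 * rho)) by (unfold Rdiv; ring).
destruct (Rtotal_order x y) as [K|[->|K]].
- specialize (Hosc x y Hx Hy K); apply Rabs_le_between in Hosc; lra.
- pose proof (Rmult_le_pos _ (2 * rho) HQm ltac:(lra)); lra.
- specialize (Hosc y x Hy Hx K); apply Rabs_le_between in Hosc; lra.
Qed.

(** The constant is half of the mean density [1 / (2 * rho)]; a density below it everywhere would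
    give area at most [1 / 2]. *)
Lemma area_density_lower (t : R) : 0 < t ->
  exists x, I x /\ / (4 * rho) <= 2 * PI * exp (2 * u x t) * f x.
Proof.
intros Ht; apply NNPP; intros Hn.
destruct (Harea t Ht) as [pr Hpr].
assert (K : RiemannInt pr <= RiemannInt (RiemannInt_P14 (- rho) rho (/ (4 * rho)))).
{ apply RiemannInt_P19; [lra|]; intros x Hx; unfold fct_cte.
  apply Rnot_lt_le; intros J; apply Hn; exists x; unfold I; lra. }
rewrite RiemannInt_P15, Hpr in K.
replace (/ (4 * rho) * (rho - - rho)) with (1 / 2) in K by (field; lra); lra.
Qed.

Lemma scal_bounded_large_times (t1 : R) : 0 < t1 ->
  exists C, forall x t, I x -> t1 <= t -> scal x t <= C.
Proof.
intros Ht1.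
destruct (continuity_ab_min f (- rho) rho) as [xm [Hm Hxm]]; [lra| |].
{ intros; eapply continuity_pt_of_derive, Hf1. }
pose proof (Hfpos xm Hxm) as Hmpos; set (m := f xm) in *.
(* A rectangle of zero height gives the spatial maximum of [H] at time [t1]. *)
destruct (rectangle_max H (- rho) rho t1 t1) as [x0 [t0 [_ [_ HM0]]]];
  [lra|lra|intros; apply H_cont; lra|].
pose (M := Rmax (H x0 t0) (Rmax (2 * (f1 rho * f1 rho)) (2 * (f1 (- rho) * f1 (- rho))))).
assert (HMs : H x0 t0 <= M /\ 2 * (f1 rho * f1 rho) <= M /\ 2 * (f1 (- rho) * f1 (- rho)) <= M).
{ repeat split.
  - apply Rmax_l.
  - eapply Rle_trans; [apply Rmax_l|apply Rmax_r].
  - eapply Rle_trans; [apply Rmax_r|apply Rmax_r]. }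
destruct HMs as [M1 [M2 M3]].
assert (HM : forall x t, I x -> t1 <= t -> H x t <= M).
{ apply H_bounded; try assumption; intros x Hx; specialize (HM0 x t1 Hx ltac:(lra)); lra. }
assert (M0 : 0 <= M) by (pose proof (Rle_0_sqr (f1 rho)) as K; unfold Rsqr in K; lra).
pose (Q := sqrt (2 * M)).
assert (HQ : 0 <= Q) by apply sqrt_pos.
assert (HQQ : Q * Q = 2 * M) by (apply sqrt_sqrt; lra).
(* At the point of [area_density_lower], [w] is [f / (2 * PI)] times the density, hence at least
   [m / (8 * PI * rho)]; the exponential is the loss in [w_harnack]. *)
pose (c := m * / (8 * PI * rho) * exp (- (2 * rho * Q / m))).
pose proof PI_RGT_0 as HPI.
assert (Hpr : 0 < PI * rho) by (now apply Rmult_lt_0_compat).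
assert (Hc : 0 < c).
{ unfold c; apply Rmult_lt_0_compat; [|apply exp_pos].
  apply Rmult_lt_0_compat; [exact Hmpos|apply Rinv_0_lt_compat; lra]. }
exists (M / c); intros x t Hx Ht.
assert (Ht0 : 0 < t) by lra.
assert (Hq : forall y, I y -> - Q <= q y t <= Q).
{ apply q_bounded with M; try assumption; [lra|intros; now apply HM| |];
  (eapply Rle_trans; [apply q_boundary; auto|lra]). }
assert (Hw : c <= w x t).
{ destruct (area_density_lower t Ht0) as [y [Hy Hden]].
  eapply Rle_trans; [|apply (w_harnack m Q t Ht0 Hmpos HQ Hm Hq x y Hx Hy)].
  apply Rmult_le_compat_r; [left; apply exp_pos|].
  specialize (Hm y Hy); fold m in Hm.
  unfold w; replace (f y * f y * exp (2 * u y t)) with (f y * (exp (2 * u y t) * f y)) by ring.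
  apply Rmult_le_compat; [lra|left; apply Rinv_0_lt_compat; lra|exact Hm|].
  apply Rmult_le_reg_l with (2 * PI); [lra|].
  replace (2 * PI * / (8 * PI * rho)) with (/ (4 * rho)) by (field; lra); lra. }
assert (HP : w x t * scal x t <= M).
{ rewrite <- P_eq_w_scal by exact Hx; specialize (HM x t Hx Ht); unfold H in HM.
  pose proof (Rle_0_sqr (q x t)) as K; unfold Rsqr in K; lra. }
apply Rnot_lt_le; intros J.
assert (HMc : 0 <= M / c) by (apply Rmult_le_pos; [|left; apply Rinv_0_lt_compat]; lra).
pose proof (Rmult_le_compat_r (scal x t) _ _ ltac:(lra) Hw).
pose proof (Rmult_lt_compat_l c _ _ Hc J) as K.
replace (c * (M / c)) with M in K by (field; lra); lra.
Qed.

(** * The bound for all positive times and its transfer to the stated form of the flow *)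

Lemma scal_bounded : exists C, forall x t, I x -> 0 < t -> scal x t <= C.
Proof.
destruct scal_bounded_small_times as [t1 [C1 [Ht1 H1]]].
destruct (scal_bounded_large_times t1 Ht1) as [C2 H2].
exists (Rmax C1 C2); intros x t Hx Ht.
destruct (Rle_lt_dec t t1).
- eapply Rle_trans; [apply H1; [exact Hx|lra]|apply Rmax_l].
- eapply Rle_trans; [apply H2; [exact Hx|lra]|apply Rmax_r].
Qed.

End Flow.

(* M = S^1 x [-rho,rho], g0 = dr^2 + f(r)^2 dtheta^2; the normalised flow is
   written g(t) = exp(2 u(r,t)) g0 (rotationally symmetric), with scaling
   factor phi(t) and r(t) = rbar t = int_M R dA_g. *)
Theorem theorem4p7
  (rho : R) (f f1 f2 : R -> R)
  (Hrho : 0 < rho)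
  (Hfs : smooth1 f)
  (Hf1 : forall x, derivable_pt_lim f x (f1 x))
  (Hf2 : forall x, derivable_pt_lim f1 x (f2 x))
  (Hfpos : forall x, -rho <= x <= rho -> 0 < f x)
  (* A_{g0}(M) = 1 *)
  (Harea0 : exists pr : Riemann_integrable (fun x => 2 * PI * f x) (- rho) rho,
              RiemannInt pr = 1)
  (* R_{g0} >= 0 *)
  (HR0 : forall x, -rho <= x <= rho -> 0 <= scal0 f f2 x)
  (* k_{g0} <= 0 on both boundary circles *)
  (Hk0r : geod0_right f f1 rho <= 0)
  (Hk0l : geod0_left f f1 rho <= 0)
  (* reflection symmetry r -> -r *)
  (Hrefl : forall x, -rho <= x <= rho -> f (- x) = f x)
  (* R_{g0} nonincreasing in |r| *)
  (Hmono : forall a b, 0 <= a -> a <= b -> b <= rho -> scal0 f f2 b <= scal0 f f2 a)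
  (* the normalised flow g(t) = exp(2u) g0, t in [0,oo) *)
  (u ur urr ut : R -> R -> R) (phi dphi rbar : R -> R)
  (Hus : smooth2_pos u)
  (Hur : forall x t, 0 < t -> derivable_pt_lim (fun y => u y t) x (ur x t))
  (Hurr : forall x t, 0 < t -> derivable_pt_lim (fun y => ur y t) x (urr x t))
  (Hut : forall x t, 0 < t -> derivable_pt_lim (fun s => u x s) t (ut x t))
  (* initial condition g(0) = g0, attained continuously *)
  (Hinit : forall x0, -rho <= x0 <= rho -> forall eps, 0 < eps ->
             exists delta, 0 < delta /\
               forall x t, -rho <= x <= rho -> Rabs (x - x0) < delta ->
                 0 < t < delta -> Rabs (u x t) < eps)
  (* r(t) = int_M R dA_g *)
  (Hrbar : forall t, 0 < t ->
     exists pr : Riemann_integrable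
        (fun x => 2 * PI * scal_conf f f1 f2 u ur urr x t * exp (2 * u x t) * f x)
        (- rho) rho,
     RiemannInt pr = rbar t)
  (* A_{g(t)}(M) = 1 *)
  (Harea : forall t, 0 < t ->
     exists pr : Riemann_integrable (fun x => 2 * PI * exp (2 * u x t) * f x)
        (- rho) rho,
     RiemannInt pr = 1)
  (* d/dt g = (r - R) g *)
  (Hflow : forall x t, -rho <= x <= rho -> 0 < t ->
     2 * ut x t = rbar t - scal_conf f f1 f2 u ur urr x t)
  (* scaling factor phi: g = phi * gtilde, t = int phi dtilde t,
     equivalently phi(0) = 1, phi' = r phi *)
  (Hphipos : forall t, 0 <= t -> 0 < phi t)
  (Hphi0 : phi 0 = 1)
  (Hphic : forall eps, 0 < eps -> exists delta, 0 < delta /\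
             forall t, 0 < t < delta -> Rabs (phi t - 1) < eps)
  (Hdphi : forall t, 0 < t -> derivable_pt_lim phi t (dphi t))
  (Hphiode : forall t, 0 < t -> dphi t = rbar t * phi t)
  (* boundary condition k_g = k_{g0} / sqrt phi *)
  (Hbdr : forall t, 0 < t ->
     geod_right f f1 u ur rho t = geod0_right f f1 rho / sqrt (phi t))
  (Hbdl : forall t, 0 < t ->
     geod_left f f1 u ur rho t = geod0_left f f1 rho / sqrt (phi t)) :
  exists C, forall x t, -rho <= x <= rho -> 0 < t ->
    scal_conf f f1 f2 u ur urr x t <= C.
destruct Hfs as [Df [Ef HDf]].
(* Uniqueness of derivatives identifies the given derivatives with the smoothness witnesses, which
   supply continuity and the mixed derivatives. *)
assert (E1 : forall x, f1 x = Df 1%nat x).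
{ intros x; apply (uniqueness_limite f x); [apply Hf1|rewrite <- Ef; apply HDf]. }
assert (E2 : forall x, f2 x = Df 2%nat x).
{ intros x; apply (uniqueness_limite f1 x); [apply Hf2|].
  apply is_derive_Reals, (is_derive_ext (Df 1%nat)); [intros; symmetry; apply E1|].
  apply is_derive_Reals, HDf. }
destruct Hus as [D [Eu HD]]; subst u.
assert (Dx : forall m n x t, 0 < t ->
  derivable_pt_lim (fun y => D m n y t) x (D (S m) n x t)) by (intros; now apply HD).
assert (Dt : forall m n x t, 0 < t ->
  derivable_pt_lim (D m n x) t (D m (S n) x t)) by (intros; now apply HD).
assert (Dc : forall m n x t, 0 < t -> continuity_2d_pt (D m n) x t).
{ intros m n x t Ht eps; destruct (HD m n x t Ht) as [_ [_ K]].
  destruct (K eps (cond_pos eps)) as [d [Hd K']].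
  exists (mkposreal d Hd); intros; now apply K'. }
assert (Er : forall x t, 0 < t -> ur x t = D 1%nat 0%nat x t).
{ intros x t Ht; apply (uniqueness_limite (fun y => D 0%nat 0%nat y t) x); auto. }
assert (Err : forall x t, 0 < t -> urr x t = D 2%nat 0%nat x t).
{ intros x t Ht; apply (uniqueness_limite (fun y => ur y t) x); [auto|].
  apply is_derive_Reals, (is_derive_ext (fun y => D 1%nat 0%nat y t));
    [intros; symmetry; now apply Er|]; apply is_derive_Reals; auto. }
assert (Et : forall x t, 0 < t -> ut x t = D 0%nat 1%nat x t).
{ intros x t Ht; apply (uniqueness_limite (D 0%nat 0%nat x) t); auto. }
assert (Es : forall x t, 0 < t ->
  scal_conf f f1 f2 (D 0%nat 0%nat) ur urr x t =
  scal_conf f f1 f2 (D 0%nat 0%nat) (D 1%nat 0%nat) (D 2%nat 0%nat) x t).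
{ intros x t Ht; unfold scal_conf; rewrite Er, Err by exact Ht; reflexivity. }
destruct (scal_bounded rho f f1 f2 (D 0%nat 0%nat) (D 1%nat 0%nat) (D 2%nat 0%nat)
  (D 0%nat 1%nat) (D 1%nat 1%nat) (D 2%nat 1%nat) phi rbar) as [C HC]; auto.
- intros x; apply continuity_pt_ext with (Df 2%nat); [intros; symmetry; apply E2|].
  eapply continuity_pt_of_derive, HDf.
- intros x t Hx Ht; rewrite <- Et, <- Es by exact Ht; now apply Hflow.
- intros t Ht; rewrite <- Hphiode by exact Ht; now apply Hdphi.
- intros t Ht; rewrite <- Hbdr by exact Ht; unfold geod_right; now rewrite Er.
- intros t Ht; rewrite <- Hbdl by exact Ht; unfold geod_left; now rewrite Er.
- exists C; intros x t Hx Ht; rewrite Es by exact Ht; now apply HC.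
Qed.
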